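(* Let $n\ge 1$, $\mathbf{r}=(r_1,\dots,r_n)\in D_n$, and let $\mathcal{X}\subset\mathcal{M}_0(\Gamma_{\mathbf{r}}\backslash\mathbb{H}_n)$ be a subset. The following are equivalent. (i) There are constants $C_1,C_2,C_3,C_-,C_+>0$ such that every $[\mathbf{A}]\in\mathcal{X}$ satisfies: (A-1) $\min\{\|X\|_{\mathbf{A}} : X\in\mathfrak{z}_{\mathbf{r}}\setminus\{0\}\}\ge C_1$; (A-2) $|\det(\tilde{\mathbf{A}})|\ge C_2$; (A-3) $d_n(\mathbf{A})\le C_3$; (A-4) $C_-\le|\rho_{\mathbf{A}}|\le C_+$. (ii) There are constants $D,V>0$ and $K\in\mathbb{R}$ such that every $[\mathbf{A}]\in\mathcal{X}$ satisfies: (1) $\mathrm{diam}(\Gamma_{\mathbf{r}}\backslash\mathbb{H}_n,\langle\cdot,\cdot\rangle_{\mathbf{A}})\le D$; (2) $\mathrm{meas}(\Gamma_{\mathbf{r}}\backslash\mathbb{H}_n,\langle\cdot,\cdot\rangle_{\mathbf{A}})\ge V$; (3) $\mathrm{Ric}_{\langle\cdot,\cdot\rangle_{\mathbf{A}}}\ge K$.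
   Context: $\mathbb{H}_n$ is the Heisenberg group of dimension $2n+1$: its Lie algebra $\mathfrak{h}_n$ has basis $X_1,\dots,X_n,Y_1,\dots,Y_n,Z$ with $[X_i,Y_i]=Z$ and all other brackets of basis elements zero; $\mathbb{H}_n$ is identified with $\mathfrak{h}_n$ via $\exp$. Put $\mathfrak{v}=\mathrm{Span}\{X_1,\dots,X_n,Y_1,\dots,Y_n\}$. Endomorphisms of $\mathfrak{h}_n$ are written as matrices in this basis. $\langle\cdot,\cdot\rangle_0$ is the scalar product making the basis orthonormal. $D_n$ is the set of $n$-tuples of positive integers with $r_i\mid r_{i+1}$ for all $i$. $\Gamma_{\mathbf{r}}<\mathbb{H}_n$ is the lattice generated by $\exp(r_1X_1),\dots,\exp(r_nX_n),\exp(Y_1),\dots,\exp(Y_n),\exp(Z)$, and $\mathfrak{z}_{\mathbf{r}}\subset\mathfrak{v}$ is its image under the projection $\mathbb{H}_n\simeq\mathfrak{h}_n\to\mathfrak{v}$ (killing $Z$), a lattice in $\mathfrak{v}$. A pair $(\tilde{\mathbf{A}},\rho_{\mathbf{A}})\in\mathrm{GL}_{2n}(\mathbb{R})\times\mathbb{R}^*$ is identified with the block matrix $\mathbf{A}=\begin{pmatrix}\tilde{\mathbf{A}}&0\\0&\rho_{\mathbf{A}}\end{pmatrix}$. It defines the left invariant Riemannian metric $\langle U,V\rangle_{\mathbf{A}}=\langle\mathbf{A}^{-1}U,\mathbf{A}^{-1}V\rangle_0$ on $\mathbb{H}_n$, with norm $\|\cdot\|_{\mathbf{A}}$, and the quotient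 metric on $\Gamma_{\mathbf{r}}\backslash\mathbb{H}_n$. The moduli space is the double coset space $\mathcal{M}_0(\Gamma_{\mathbf{r}}\backslash\mathbb{H}_n)=\Pi_{\mathbf{r}}\backslash(\mathrm{GL}_{2n}(\mathbb{R})\times\mathbb{R}^* )/(\mathrm{O}(2n)\times\{\pm1\})$. Here $\mathbf{J}_n=\begin{pmatrix}0&\mathbf{I}_n\\-\mathbf{I}_n&0\end{pmatrix}$, $\widetilde{\mathrm{Sp}}(2n,\mathbb{R})=\{\mathbf{S}\in \mathrm{GL}_{2n}(\mathbb{R}):{}^t\mathbf{S}\mathbf{J}_n\mathbf{S}=\epsilon(\mathbf{S})\mathbf{J}_n,\ \epsilon(\mathbf{S})=\pm1\}$, $G_{\mathbf{r}}=\mathbf{diag}(\mathbf{r})\,\mathrm{GL}_{2n}(\mathbb{Z})\,\mathbf{diag}(\mathbf{r})^{-1}$ with $\mathbf{diag}(\mathbf{r})=\mathrm{diag}(r_1,\dots,r_n,1,\dots,1)$, and $\Pi_{\mathbf{r}}=\left\{\begin{pmatrix}\mathbf{S}&0\\0&\epsilon(\mathbf{S})\end{pmatrix}:\mathbf{S}\in G_{\mathbf{r}}\cap\widetilde{\mathrm{Sp}}(2n,\mathbb{R})\right\}$; the groups act by block matrix multiplication. $[\mathbf{A}]$ denotes the class of $\mathbf{A}$. The numbers $0<d_1(\mathbf{A})\le\dots\le d_n(\mathbf{A})$ are such that $\pm\sqrt{-1}\,d_1(\mathbf{A}),\dots,\pm\sqrt{-1}\,d_n(\mathbf{A})$ are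 the eigenvalues of the operator $j_{\mathbf{A}}:\mathfrak{v}\to\mathfrak{v}$ defined by $\langle j_{\mathbf{A}}(U),V\rangle_{\mathbf{A}}=\omega([U,V])$ for $U,V\in\mathfrak{v}$, where $\omega$ is the covector with $\omega(Z)=1$, $\ker\omega=\mathfrak{v}$ (equivalently, the eigenvalues of ${}^t\tilde{\mathbf{A}}\mathbf{J}_n\tilde{\mathbf{A}}$). All quantities in (i) and (ii) depend only on $[\mathbf{A}]$. $\mathrm{meas}$ is the total Riemannian volume; $\mathrm{Ric}\ge K$ means $\mathrm{Ric}(u,u)\ge K$ for all unit vectors $u$. *)

(* Defs.v *)
From HB Require Import structures.
From mathcomp Require Import all_boot all_order all_algebra.
From mathcomp Require Import all_classical all_reals all_analysis.
From mathcomp Require Import complex.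

Set Implicit Arguments.
Unset Strict Implicit.
Unset Printing Implicit Defensive.

Import Order.TTheory GRing.Theory Num.Theory.
Import numFieldNormedType.Exports.

Local Open Scope classical_set_scope.
Local Open Scope ring_scope.

(* Riemannian geometry of a metric on R^N in its global coordinates.  The     *)
(* metric is a field g of Gram matrices, g x i j = <d_i, d_j> at x.  Nothing  *)
(* here requires g x to be symmetric positive definite; it is for the metrics *)
(* to which these definitions are applied.                                    *)
Section Riemannian.
Context {R : realType} {N : nat}.
Implicit Types (g : 'cV[R]_N -> 'M[R]_N) (x p q u v : 'cV[R]_N).

Definition form (G : 'M[R]_N) u v : R := (u^T *m G *m v) 0 0.

Definition pderiv (k : 'I_N) (f : 'cV[R]_N -> R) x : R :=
  'D_(delta_mx k 0) f x.

(* Gamma^l_{ij} *)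
Definition christoffel g (l i j : 'I_N) x : R :=
  2^-1 * \sum_(m < N) invmx (g x) l m *
    (pderiv i (fun y => g y j m) x + pderiv j (fun y => g y i m) x
     - pderiv m (fun y => g y i j) x).

(* The d_l-component of R(d_i, d_j) d_k, for the sign convention              *)
(* R(U, V) = nabla_U nabla_V - nabla_V nabla_U - nabla_[U, V].                *)
Definition riemann g (l i j k : 'I_N) x : R :=
  pderiv i (christoffel g l j k) x - pderiv j (christoffel g l i k) x
  + \sum_(m < N) (christoffel g m j k x * christoffel g l i m x
                  - christoffel g m i k x * christoffel g l j m x).

(* Ric(U, V) is the trace of W |-> R(W, U) V. *)
Definition ricci g x : 'M[R]_N :=
  \matrix_(j, k) \sum_(i < N) riemann g i i j k x.

Definition ricci_ge g (K : R) : Prop :=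
  forall x u, form (g x) u u = 1 -> K <= form (ricci g x) u u.

(* A curve is C^1 on a closed interval when it agrees there with a C^1 curve  *)
(* defined on the whole line.                                                 *)
Definition C1_on (c : R -> 'cV[R]_N) (a b : R) : Prop :=
  exists f : R -> 'cV[R]_N,
    [/\ forall t, derivable f t 1, continuous (derive1 f)
      & forall t, a <= t <= b -> c t = f t].

(* The values of c outside [0, 1] are irrelevant. *)
Definition piecewise_C1 (c : R -> 'cV[R]_N) : Prop :=
  exists s : seq R,
    [/\ sorted <%R s, s`_0 = 0, last 0 s = 1
      & forall i, (i.+1 < size s)%N -> C1_on c s`_i s`_i.+1].

Definition curve_length g (c : R -> 'cV[R]_N) : \bar R :=
  (\int[lebesgue_measure]_(t in `[0%R, 1%R])
     (Num.sqrt (form (g (c t)) (derive1 c t) (derive1 c t)))%:E)%E.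

(* For a group acting freely, properly and isometrically, with orbits orb x:  *)
(* curves in the quotient are the projections of curves upstairs, with the    *)
(* same length, and may end at any points of the two orbits.                  *)
Definition quotient_dist g (orb : 'cV[R]_N -> set 'cV[R]_N) p q : \bar R :=
  ereal_inf [set curve_length g c | c in
    [set c : R -> 'cV[R]_N | [/\ piecewise_C1 c, orb p (c 0) & orb q (c 1)]]].

Definition quotient_diam g (orb : 'cV[R]_N -> set 'cV[R]_N) : \bar R :=
  ereal_sup [set quotient_dist g orb pq.1 pq.2 | pq in
    [set: 'cV[R]_N * 'cV[R]_N]].

End Riemannian.

(* Integral over R^N with respect to Lebesgue measure, as an iterated         *)
(* integral; it is only used for nonnegative Borel functions (Tonelli).       *)
Fixpoint integralN (R : realType) (N : nat) :
    ('cV[R]_N -> \bar R) -> \bar R :=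
  match N with
  | 0%N => fun f => f 0
  | M.+1 => fun f => (\int[lebesgue_measure]_(t in [set: R])
      integralN (fun y : 'cV[R]_M => f (col_mx (t%:M : 'cV[R]_1) y)))%E
  end.

Section Volume.
Context {R : realType} {N : nat}.
Implicit Types (g : 'cV[R]_N -> 'M[R]_N) (E : set 'cV[R]_N).

Definition borel E : Prop := <<s [set U : set 'cV[R]_N | open U] >> E.

Definition volume g E : \bar R :=
  integralN (fun x => (Num.sqrt (\det (g x)) * \1_E x)%:E).

(* The projection to the quotient preserves the measure of the Borel sets on  *)
(* which it is injective, and a Borel fundamental domain is such a set; so    *)
(* the supremum is the volume of a fundamental domain.                        *)
Definition quotient_meas g (orb : 'cV[R]_N -> set 'cV[R]_N) : \bar R :=
  ereal_sup [set volume g E | E in [set E |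
    borel E /\ forall x y, E x -> E y -> orb x y -> x = y]].

End Volume.

(* The Heisenberg group.  A vector of R^(n + n + 1) holds the coordinates of  *)
(* an element of the Lie algebra in the basis X_1..X_n, Y_1..Y_n, Z; the      *)
(* group is the same set, exp being the identity map.                         *)
Section Heisenberg.
Context {R : realType} {n : nat}.
Local Notation v := 'cV[R]_(n + n).
Local Notation h := 'cV[R]_(n + n + 1).

Definition iX (i : 'I_n) : 'I_(n + n + 1) := lshift 1 (lshift n i).
Definition iY (i : 'I_n) : 'I_(n + n + 1) := lshift 1 (rshift n i).
Definition iZ : 'I_(n + n + 1) := rshift (n + n) ord0.

Definition basisX (i : 'I_n) : h := delta_mx (iX i) 0.
Definition basisY (i : 'I_n) : h := delta_mx (iY i) 0.
Definition basisZ : h := delta_mx iZ 0.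

Definition bracket (x y : h) : h :=
  (\sum_(i < n) (x (iX i) 0 * y (iY i) 0 - x (iY i) 0 * y (iX i) 0))
    *: basisZ.

(* Baker-Campbell-Hausdorff in a 2-step nilpotent algebra. *)
Definition hmul (x y : h) : h := x + y + 2^-1 *: bracket x y.
Definition hinv (x : h) : h := - x.

Definition omega (x : h) : R := x iZ 0.
Definition of_v (U : v) : h := col_mx U 0.
Definition proj_v (x : h) : v := usubmx x.

Definition is_subgroup (H : set h) : Prop :=
  [/\ H 0, forall x y, H x -> H y -> H (hmul x y)
    & forall x, H x -> H (hinv x)].

Definition Gamma_gens (r : n.-tuple nat) : set h :=
  [set x | (exists i, x = (tnth r i)%:R *: basisX i)
        \/ (exists i, x = basisY i) \/ x = basisZ].

Definition Gamma (r : n.-tuple nat) : set h :=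
  smallest is_subgroup (Gamma_gens r).

Definition zlattice (r : n.-tuple nat) : set v := proj_v @` Gamma r.

Definition Gamma_orbit (r : n.-tuple nat) (x : h) : set h :=
  [set hmul gam x | gam in Gamma r].

(* A pair (A~, rho_A); the elements of GL_2n(R) x R^* form the set GLR. *)
Local Notation pair := ('M[R]_(n + n) * R)%type.
Implicit Types (A B : pair).

Definition GLR : set pair := [set A | A.1 \in unitmx /\ A.2 != 0].

Definition blockmx A : 'M[R]_(n + n + 1) := block_mx A.1 0 0 (A.2)%:M.

Definition inner0 m (x y : 'cV[R]_m) : R := (x^T *m y) 0 0.

Definition inner A (x y : h) : R :=
  inner0 (invmx (blockmx A) *m x) (invmx (blockmx A) *m y).

Definition normA A (x : h) : R := Num.sqrt (inner A x x).

(* The left-invariant metric on the group: tangent vectors at x are carried   *)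
(* to the identity by the differential at x of left translation by x^-1.      *)
Definition to_identity (x u : h) : h := 'D_u (hmul (hinv x)) x.

Definition metric A (x : h) : 'M[R]_(n + n + 1) :=
  \matrix_(i, j) inner A (to_identity x (delta_mx i 0))
                         (to_identity x (delta_mx j 0)).

Definition Jmx : 'M[R]_(n + n) := block_mx 0 1%:M (- 1%:M) 0.

Definition diag_r (r : n.-tuple nat) : 'M[R]_(n + n) :=
  diag_mx (row_mx (\row_i (tnth r i)%:R) (const_mx 1)).

Definition G_r (r : n.-tuple nat) : set 'M[R]_(n + n) :=
  [set diag_r r *m map_mx intr M *m invmx (diag_r r) |
    M in [set M : 'M[int]_(n + n) | M \in unitmx]].

(* S belongs to Sp~(2n, R), with epsilon(S) = e *)
Definition Spt (e : R) (S : 'M[R]_(n + n)) : Prop :=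
  [/\ S \in unitmx, e = 1 \/ e = -1 & S^T *m Jmx *m S = e *: Jmx].

Definition Pi_r (r : n.-tuple nat) : set pair :=
  [set P | G_r r P.1 /\ Spt P.2 P.1].

Definition OxPM1 : set pair :=
  [set Q | Q.1^T *m Q.1 = 1%:M /\ (Q.2 = 1 \/ Q.2 = -1)].

(* [A], as a double coset *)
Definition dclass (r : n.-tuple nat) A : set pair :=
  [set B | exists P Q : pair, [/\ Pi_r r P, OxPM1 Q
    & blockmx B = blockmx P *m blockmx A *m blockmx Q]].

Definition moduli (r : n.-tuple nat) : set (set pair) :=
  [set dclass r A | A in GLR].

Definition is_j A (j : 'M[R]_(n + n)) : Prop :=
  forall U V : v,
    inner A (of_v (j *m U)) (of_v V) = omega (bracket (of_v U) (of_v V)).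

(* d = (d_1(A), ..., d_n(A)); eigenvalues are counted with multiplicity. *)
Definition is_dvals A (d : n.-tuple R) : Prop :=
  [/\ all (fun t => 0 < t) d, sorted <=%R d &
    exists2 j, is_j A j &
      char_poly (map_mx (real_complex R) j) =
      \prod_(t <- d) (('X - (Complex 0 t)%:P) * ('X - (Complex 0 (- t))%:P))].

Definition Dset : set (n.-tuple nat) :=
  [set r | all (fun k => 0 < k)%N r /\ sorted dvdn r].

(* The set below is a set of nonzero lattice vectors, so its infimum is a     *)
(* minimum.                                                                   *)
Definition min_norm (r : n.-tuple nat) A : R :=
  inf [set normA A (of_v U) | U in zlattice r `\ 0].

End Heisenberg.

(* Main.v *)
From HB Require Import structures.
Require Import Defs.
From mathcomp Require Import all_boot all_order all_algebra.
From mathcomp Require Import all_classical all_reals all_analysis.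
From mathcomp Require Import measurable_realfun.
From mathcomp Require Import perm spectral complex ring lra zify.

Set Implicit Arguments.
Unset Strict Implicit.
Unset Printing Implicit Defensive.

Import Order.TTheory GRing.Theory Num.Theory.
Import numFieldNormedType.Exports.

(** Write [B = A.1], [rho = A.2], [m = 2 n], [k = B^T J B], and let [Q] be the Gram
    matrix of the lattice z_r, that is [diag_r^T (B B^T)^-1 diag_r]. Both sides of
    the equivalence are statements about a few numbers attached to [B] and [rho].

    - The systole of [Q] is the square of the minimal norm, and [\det Q] is
      [(\prod r_i)^2 / (\det B)^2].
    - The matrix [k] is skew, with eigenvalues [+- i d_j]; hence [\prod d_j] is
      [`|\det B|] and the squared Frobenius norm of [k] is [2 \sum d_j^2]
      ([skew_eigenvalues], [det_skew], [sum_skew]).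
    - In the global coordinates the metric is [(B B^T)^-1] on v plus
      [rho^-2 alpha alpha^T], where [alpha] is a covector field with affine
      coefficients. Its density is the constant [1 / `|rho \det B|], and the volume of
      the quotient is this constant up to factors that depend on [r]
      ([quotient_meas_le], [quotient_meas_ge]).
    - The Ricci form is [- (rho^-2 / 2) |k w|^2] on a vector [B w] of v and it is
      nonnegative along Z ([form_ricci]). A lower bound for it amounts to an
      upper bound for [rho^-2 \sum d_j^2].
    - The projection of the quotient to the torus of z_r is a Riemannian submersion
      with circle fibres of length [1 / `|rho|]. So the diameter is at least the
      covering radius of [Q], and it is bounded in terms of this radius and of
      [1 / `|rho|] ([covering_of_diam], [diam_of_covering]).

    The geometry of numbers relates the systole, the determinant and the covering
    radius of [Q]. Reduction theory ([reduction]) provides a basis of the lattice in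
    which [Q] is, up to a unitriangular matrix with small entries, diagonal with
    entries [a_i] that are increasing up to a constant factor. The determinant is the
    product of the [a_i], the systole bounds all of them from below, the covering
    radius bounds all of them from above. Consequently the systole and the
    determinant together bound the covering radius, and the covering radius and the
    determinant together bound the systole.

    For the direct implication, the systole and [`|\det B| >= C2] bound the covering radius, hence
    with [`|rho| >= C_-] the diameter; the systole alone bounds [\det Q] from
    below, that is [`|\det B|] from above, hence with [`|rho| <= C_+] the volume from
    below; the bounds of [d_n] and [`|rho|] give the one of the Ricci curvature.

    For the converse, the diameter bounds the covering radius, hence [\det Q] from
    above, that is [`|\det B|] from below. The Ricci bound gives [\sum d_j^2 <= c rho^2], while
    [\prod d_j^2 = (\det B)^2] keeps [d_n] away from 0; so [`|rho|] is bounded from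
    below. The volume bounds [`|rho \det B|] from above, hence also each of the two
    factors; then [d_n] is bounded, and the covering radius and the determinant
    bound the systole from below. *)

Local Open Scope classical_set_scope.
Local Open Scope ring_scope.

Local Notation form := Defs.form.
Local Notation integralN := Defs.integralN.

(** * Reduction of positive definite quadratic forms *)

Section Reduction.
Context {R : realType}.
Local Notation rmx := (map_mx (intr : int -> R)).

Lemma form_congr p q (G : 'M[R]_p) (P : 'M[R]_(p, q)) (x y : 'cV[R]_q) :
  form (P^T *m G *m P) x y = form G (P *m x) (P *m y).
Proof. by rewrite /form trmx_mul !mulmxA. Qed.

Lemma form_diag p (a : 'rV[R]_p) (x : 'cV[R]_p) :
  form (diag_mx a) x x = \sum_i a 0 i * x i 0 ^+ 2.
Proof.
rewrite /form mxE; apply: eq_bigr => i _.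
rewrite mul_mx_diag !mxE; ring.
Qed.

Lemma form_delta p (G : 'M[R]_p) i j :
  form G (delta_mx i 0) (delta_mx j 0) = G i j.
Proof. by rewrite /form trmx_delta -rowE -colE !mxE. Qed.

(** Positive definiteness in quantitative form: it passes to congruent forms and
    to Schur complements without a compactness argument. *)
Definition coercive p (G : 'M[R]_p) :=
  exists2 c : R, 0 < c & forall x : 'cV[R]_p, c * (\sum_i x i 0 ^+ 2) <= form G x x.

Lemma cV_neq0 p (z : 'cV[int]_p) : z != 0 -> exists i, z i 0 != 0.
Proof.
move=> z0; apply/existsP; apply: contraNT z0; rewrite negb_exists => /forallP z0.
by apply/eqP/colP => i; rewrite mxE; apply/eqP; rewrite -[_ == _]negbK.
Qed.

(** A nonzero integer vector has Euclidean norm at least one. *)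
Lemma coercive_int p (G : 'M[R]_p) : coercive G ->
  exists2 c : R, 0 < c &
    forall z : 'cV[int]_p, z != 0 -> c <= form G (rmx z) (rmx z).
Proof.
case=> c c0 cP; exists c => // z z0; apply: le_trans (cP _).
rewrite ler_peMr ?(ltW c0)//.
have [i zi] := cV_neq0 z0.
rewrite (bigD1 i)//= ler_wpDr ?sumr_ge0// => [j _|]; first exact: sqr_ge0.
rewrite mxE -rmorphXn/= ler1z.
by rewrite -gtz0_ge1 lt_def sqr_ge0 andbT sqrf_eq0.
Qed.

Lemma cauchy_schwarz (I : finType) (u v : I -> R) :
  (\sum_i u i * v i) ^+ 2 <= (\sum_i u i ^+ 2) * (\sum_i v i ^+ 2).
Proof.
set A := \sum_i u i ^+ 2; set B := \sum_i u i * v i; set C := \sum_i v i ^+ 2.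
have A0 : 0 <= A by apply: sumr_ge0 => i _; exact: sqr_ge0.
have [AE|An] := eqVneq A 0.
  have B0 : B = 0.
    apply: big1 => i _; suff /eqP : u i ^+ 2 = 0 by rewrite sqrf_eq0 => /eqP ->; rewrite mul0r.
    by apply: (psumr_eq0P _ AE) => // j _; exact: sqr_ge0.
  by rewrite B0 AE expr0n mul0r.
have : 0 <= \sum_i (A * v i - B * u i) ^+ 2 by apply: sumr_ge0 => i _; exact: sqr_ge0.
have -> : \sum_i (A * v i - B * u i) ^+ 2 = A * (A * C - B ^+ 2).
  transitivity (\sum_i (A ^+ 2 * v i ^+ 2 - 2 * A * B * (u i * v i) + B ^+ 2 * u i ^+ 2)).
    by apply: eq_bigr => i _; ring.
  by rewrite big_split /= sumrB -!mulr_sumr -/A -/B -/C; ring.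
by rewrite pmulr_rge0 ?subr_ge0// lt0r An.
Qed.

Lemma mulmx_bound p q (Q : 'M[R]_(p, q)) :
  exists2 C : R, 0 < C &
    forall x : 'cV[R]_q, \sum_i (Q *m x) i 0 ^+ 2 <= C * \sum_i x i 0 ^+ 2.
Proof.
have C0 : 0 <= \sum_i \sum_j Q i j ^+ 2.
  by apply: sumr_ge0 => i _; apply: sumr_ge0 => j _; exact: sqr_ge0.
exists (1 + \sum_i \sum_j Q i j ^+ 2) => [|x]; first by lra.
rewrite mulrDl mul1r ler_wpDl ?sumr_ge0// => [i _|]; first exact: sqr_ge0.
rewrite mulr_suml; apply: ler_sum => i _; rewrite mxE.
exact: (cauchy_schwarz (Q i) (x ^~ 0)).
Qed.

Lemma coercive1 p : coercive (1%:M : 'M[R]_p).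
Proof.
exists 1 => // x; rewrite mul1r -diag_const_mx form_diag.
by rewrite le_eqVlt; apply/orP; left; apply/eqP/eq_bigr => i _; rewrite mxE mul1r.
Qed.

Lemma coercive_congr p (G P : 'M[R]_p) : P \in unitmx -> coercive G ->
  coercive (P^T *m G *m P).
Proof.
move=> Pu [c c0 cP]; have [C C0 CP] := mulmx_bound (invmx P).
exists (c / C) => [|x]; first exact: divr_gt0.
rewrite form_congr; apply: le_trans (cP _).
rewrite -mulrA ler_pM2l// ler_pdivrMl//.
by have := CP (P *m x); rewrite mulKmx.
Qed.

Lemma round_half (x : R) : exists k : int, `|k%:~R + x| <= 2^-1.
Proof.
exists (- Num.floor (x + 2^-1)); rewrite ler_norml rmorphN /=.
have := floor_le (x + 2^-1); have := floorD1_gt (x + 2^-1).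
rewrite rmorphD /=; lra.
Qed.

Lemma form_lift p (a : R) (G : 'M[R]_p) (c : 'cV[R]_1) (x : 'cV[R]_p) :
  form (block_mx a%:M 0 0 G) (col_mx c x) (col_mx c x)
  = a * c 0 0 ^+ 2 + form G x x.
Proof.
rewrite /form tr_col_mx mul_row_block !mulmx0 addr0 add0r mul_row_col mxE.
by congr (_ + _); rewrite mul_mx_scalar -scalemxAl !mxE big_ord1 !mxE expr2.
Qed.

Lemma congr_block p (a : R) (t : 'rV[R]_p) (V G : 'M[R]_p) :
  (block_mx 1%:M t 0 V)^T *m block_mx a%:M 0 0 G *m block_mx 1%:M t 0 V =
  block_mx a%:M (a *: t) (a *: t^T) (a *: t^T *m t + V^T *m G *m V).
Proof.
rewrite tr_block_mx !mulmx_block !trmx1 !trmx0.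
rewrite !mul0mx !mulmx0 !mul1mx !mulmx1 !addr0 !add0r.
by rewrite !mul_mx_scalar !mul_scalar_mx mul0mx addr0.
Qed.

(** The lower block [G'] is the Schur complement of the first diagonal entry. *)
Lemma complete_square p (G : 'M[R]_(1 + p)) : G^T = G -> G 0 0 != 0 ->
  exists (b : 'rV[R]_p) (G' : 'M[R]_p), G'^T = G' /\
    G = (block_mx 1%:M b 0 1%:M)^T *m block_mx (G 0 0)%:M 0 0 G'
        *m block_mx 1%:M b 0 1%:M.
Proof.
move=> Gs G0; set a := G 0 0.
have ul : ulsubmx G = a%:M.
  by apply/matrixP => i j; rewrite !ord1 !mxE eqxx mulr1n /a; congr (G _ _); apply/val_inj.
have dl : dlsubmx G = (ursubmx G)^T by rewrite trmx_ursub Gs.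
exists (a^-1 *: ursubmx G), (drsubmx G - a^-1 *: ((ursubmx G)^T *m ursubmx G)).
split.
  rewrite linearB /= linearZ /= trmx_mul trmxK trmx_drsub Gs //.
rewrite tr_block_mx !mulmx_block !trmx1 !trmx0 !mulmx0 !mul0mx !mul1mx !mulmx1 !addr0 !add0r.
rewrite mul_scalar_mx scalerA divff // scale1r linearZ /= mul_mx_scalar scalerA divff // scale1r.
rewrite -scalemxAr subrKC -ul -dl -[LHS]submxK; congr block_mx.
Qed.

(** Hermite reduction. The basis is chosen one vector at a time. The first vector
    has a value of the form within a factor 2 of the infimum over the first
    vectors of all bases of the lattice; comparing bases rather than vectors
    avoids completing a primitive vector to a basis, and the factor 2 avoids
    showing that the infimum is attained. After the square is completed, the
    Schur complement is reduced by induction, and adding multiples of the first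
    vector to the others makes the first row of [T] small. The second vector of
    the new basis also starts a basis, so [a_0 <= 2 * (a_0 / 4 + a_1)], that is
    [a_0 <= 4 * a_1]: the sequence [a] drops by at most a factor 4 per step. *)
Lemma reduction p (G : 'M[R]_p) : G^T = G -> coercive G ->
  exists (U : 'M[int]_p) (a : 'rV[R]_p) (T : 'M[R]_p),
    [/\ U \in unitmx,
        (forall i, 0 < a 0 i) /\ (forall i j : 'I_p, (i <= j)%N -> a 0 i <= 4 ^+ p * a 0 j),
        (forall i j : 'I_p, (j < i)%N -> T i j = 0) /\ (forall i, T i i = 1),
        forall i j : 'I_p, (i < j)%N -> `|T i j| <= 2^-1
      & (rmx U)^T *m G *m rmx U = T^T *m diag_mx a *m T].
Proof.
elim: p G => [|p IHp] G Gs Gc.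
  exists 1%:M, 0, 1%:M; rewrite unitmx1; split => //.
  - by split=> -[].
  - by split=> -[].
  - by case.
  - by apply/matrixP => -[].
have [c c0 cP] := coercive_int Gc.
(* [S] holds the values of the form at the first vectors of all the bases. *)
set S := [set form G (rmx (U *m delta_mx 0 0)) (rmx (U *m delta_mx 0 0))
  | U in [set U : 'M[int]_p.+1 | U \in unitmx]].
have SP : lbound S c.
  move=> _ [U /= Uu <-]; apply: cP.
  apply/negP => /eqP /(congr1 (mulmx (invmx U))); rewrite mulKmx // mulmx0.
  by move/matrixP/(_ 0 0); rewrite !mxE.
have Sn : S !=set0 by eexists; exists 1%:M => //; rewrite /= unitmx1.
have Sinf : has_inf S by split=> //; exists c.
have inf0 : 0 < inf S by apply: lt_le_trans c0 _; exact: lb_le_inf.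
have [_ [U0 /= U0u <-] U0lt] := inf_adherent inf0 Sinf.
have {U0lt} U0P U : U \in unitmx ->
    form G (rmx (U0 *m delta_mx 0 0)) (rmx (U0 *m delta_mx 0 0)) <=
    2 * form G (rmx (U *m delta_mx 0 0)) (rmx (U *m delta_mx 0 0)).
  move=> Uu; have : inf S <= form G (rmx (U *m delta_mx 0 0)) (rmx (U *m delta_mx 0 0)).
    by apply: ge_inf; [exists c|exists U].
  lra.
set G1 := (rmx U0)^T *m G *m rmx U0.
have rU0 : rmx U0 \in unitmx by rewrite unitmxE det_map_mx rmorph_unit.
have G1s : G1^T = G1 by rewrite /G1 !trmx_mul trmxK Gs mulmxA.
have a0E : G1 0 0 = form G (rmx (U0 *m delta_mx 0 0)) (rmx (U0 *m delta_mx 0 0)).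
  by rewrite map_mxM map_delta_mx -form_congr form_delta.
have a0_gt0 : 0 < G1 0 0.
  by rewrite a0E; apply: lt_le_trans c0 _; apply: SP; exists U0.
have G1c : coercive G1 by exact: coercive_congr.
have [b [G' [G's G1E]]] := complete_square G1s (lt0r_neq0 a0_gt0).
set a0 := G1 0 0 in a0E a0_gt0 G1E.
(* [G'] is the minimum of the form over the first coordinate. *)
have G'c : coercive G'.
  have [d d0 dP] := G1c; exists d => // x.
  have := dP (col_mx (- (b *m x)) x).
  have blk : block_mx 1%:M b 0 1%:M *m col_mx (- (b *m x)) x = col_mx 0 x.
    by rewrite mul_block_col !mul1mx mul0mx add0r addNr.
  rewrite G1E form_congr blk form_lift.
  rewrite mxE expr0n mulr0 add0r; apply: le_trans.
  rewrite ler_pM2l// big_ord_recl /= ler_wpDl ?sqr_ge0// le_eqVlt; apply/orP; left; apply/eqP.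
  apply: eq_bigr => i _; have -> : lift 0 i = rshift 1 i by apply/val_inj.
  by congr (_ ^+ 2); exact: esym (col_mxEd (- (b *m x)) x i 0).
have [U' [a' [T' [U'u [a'0 a'le] [T'0 T'1] T'le U'E]]]] := IHp G' G's G'c.
have [k kP] : exists k : 'rV[int]_p, forall j, `|(rmx k + b *m rmx U') 0 j| <= 2^-1.
  have /choice[f fP] (j : 'I_p) := round_half ((b *m rmx U') 0 j).
  by exists (\row_j f j) => j; move: (fP j); rewrite !mxE.
set t := rmx k + b *m rmx U' in kP.
set U1 := block_mx 1%:M k 0 U' : 'M[int]_(1 + p).
have U1u : U1 \in unitmx by rewrite unitmxE det_ublock det1 mul1r -unitmxE.
have UE : block_mx 1%:M b 0 1%:M *m rmx U1 = block_mx 1%:M t 0 (rmx U').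
  rewrite /U1 map_block_mx map_mx1 map_mx0 mulmx_block !mul1mx !mul0mx !mulmx0.
  by rewrite !addr0 add0r.
pose U : 'M[int]_(p.+1) := U0 *m (U1 : 'M[int]_p.+1).
pose T : 'M[R]_(1 + p) := block_mx 1%:M t 0 T'.
pose a : 'rV[R]_(1 + p) := row_mx (const_mx a0) a'.
have Uu : U \in unitmx by rewrite unitmx_mul U0u.
have GE : (rmx U)^T *m G *m rmx U = T^T *m diag_mx a *m T.
  have -> : (rmx U)^T *m G *m rmx U = (rmx U1)^T *m G1 *m rmx U1.
    by rewrite /U map_mxM trmx_mul !mulmxA.
  rewrite G1E -!mulmxA UE mulmxA -trmx_mul UE.
  rewrite /T/a diag_mx_row diag_const_mx !mulmxA !congr_block U'E.
  by [].
have aL : a 0 (lshift p 0) = a0 by rewrite row_mxEl mxE.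
have aR j : a 0 (rshift 1 j) = a' 0 j by rewrite row_mxEr.
have TRR i j : T (rshift 1 i) (rshift 1 j) = T' i j by rewrite block_mxEdr.
have TLR j : T (lshift p 0) (rshift 1 j) = t 0 j by rewrite block_mxEur.
have TLL : T (lshift p 0) (lshift p 0) = 1 by rewrite block_mxEul mxE.
have TRL i : T (rshift 1 i) (lshift p 0) = 0 by rewrite block_mxEdl mxE.
clearbody a T t.
have ordL : ord0 = lshift p 0 :> 'I_(1 + p) by apply/val_inj.
have ordR (i : 'I_p) : lift (@lshift 1 p 0 : 'I_p.+1) i = rshift 1 i :> 'I_p.+1 by apply/val_inj.
(* Exchanging the first two vectors gives a basis that [U0] competes with. *)
have first (j : 'I_p) : val j = 0%N -> a0 <= 4 * a' 0 j.
  move=> j0; set j1 : 'I_p.+1 := rshift 1 j.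
  have := U0P (U *m tperm_mx 0 j1) _.
  have -> : U *m tperm_mx 0 j1 *m delta_mx 0 0 = U *m delta_mx j1 0 :> 'cV[int]_p.+1.
    rewrite -mulmxA -xrowE; congr (_ *m _); apply/matrixP => i k'.
    by rewrite !mxE ord1 eqxx !andbT -[in RHS](inj_eq (@perm_inj _ (tperm 0 j1))) tpermR.
  rewrite unitmx_mul Uu unitmx_perm => /(_ isT).
  rewrite -a0E map_mxM map_delta_mx -form_congr GE form_congr form_diag.
  rewrite big_ord_recl -colE !mxE ordL aL TLR.
  rewrite (bigD1 j)//= ordR aR !mxE TRR T'1.
  rewrite big1 ?addr0 => [|i ij]; last first.
    rewrite ordR !mxE TRR T'0 ?expr0n ?mulr0// j0 lt0n.
    by apply: contraNneq ij => i0; apply/eqP/val_inj; rewrite /= j0.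
  have : t 0 j ^+ 2 <= 2^-1 ^+ 2.
    by rewrite -real_normK ?num_real// ler_pXn2r ?nnegrE ?invr_ge0.
  move=> /(ler_wpM2l (ltW a0_gt0)); lra.
have split0 (i : 'I_p.+1) : i = ord0 \/ exists i' : 'I_p, i = rshift 1 i'.
  case: (split_ordP (i : 'I_(1 + p))) => i' ->; last by right; exists i'.
  by left; apply/val_inj; rewrite /= ord1.
exists U, a, T; split => //.
- split=> [i|i j]; first by case: (split0 i) => [->|[i' ->]]; rewrite ?ordL ?aL ?aR.
  have p4 q : 1 <= 4 ^+ q :> R by apply: exprn_ege1; lra.
  case: (split0 i) => [->|[i' ->]]; case: (split0 j) => [->|[j' ->]] //=.
  + by rewrite ordL aL ler_peMl ?(ltW a0_gt0).
  + have p0 : (0 < p)%N by apply: leq_ltn_trans (ltn_ord j').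
    rewrite ordL aL aR => _; apply: le_trans (first (Ordinal p0) erefl) _.
    by rewrite exprS -mulrA ler_pM2l// a'le.
  + by rewrite !aR => ij; apply: le_trans (a'le _ _ ij) _;
      rewrite ler_pM2r// exprS ler_peMl ?exprn_ge0 ?ler1n.
- split=> [i j|i].
    case: (split0 i) => [->|[i' ->]]; case: (split0 j) => [->|[j' ->]] //=.
      by rewrite ordL TRL.
    by rewrite TRR => ij; apply: T'0.
  by case: (split0 i) => [->|[i' ->]]; rewrite ?ordL ?TLL ?TRR.
- move=> i j; case: (split0 i) => [->|[i' ->]]; case: (split0 j) => [->|[j' ->]] //=.
    by rewrite ordL TLR.
  by rewrite TRR => ij; apply: T'le.
Qed.

End Reduction.

(** * Systole, determinant and covering radius of a lattice *)

Section LatticeInvariants.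
Context {R : realType}.
Local Notation rmx := (map_mx (intr : int -> R)).

(** Coordinates are rounded from the last one to the first: since [T] is upper
    unitriangular, changing the coordinate [i] of [z] does not disturb the
    coordinates of [T *m (w + z)] after [i], and moves coordinate [i] by integers. *)
Lemma nearest_plane p (T : 'M[R]_p) (w : 'cV[R]_p) :
  (forall i j : 'I_p, (j < i)%N -> T i j = 0) -> (forall i, T i i = 1) ->
  exists z : 'cV[int]_p, forall i, `|(T *m (w + rmx z)) i 0| <= 2^-1.
Proof.
move=> T0 T1; suff : forall k, exists z : 'cV[int]_p,
    forall i : 'I_p, (p <= i + k)%N -> `|(T *m (w + rmx z)) i 0| <= 2^-1.
  by move=> /(_ p)[z zP]; exists z => i; apply: zP; rewrite leq_addl.
elim=> [|k [z zP]]; first by exists 0 => i; rewrite addn0 leqNgt ltn_ord.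
have [kp|pk] := ltnP k p; last by exists z => i _; apply: zP; lia.
have ip : (p - k.+1 < p)%N by lia.
set i0 := Ordinal ip.
have [m mP] := round_half ((T *m (w + rmx z)) i0 0).
exists (z + m *: delta_mx i0 0) => i ki.
have -> : (T *m (w + rmx (z + m *: delta_mx i0 0))) i 0 =
    (T *m (w + rmx z)) i 0 + m%:~R * T i i0.
  rewrite map_mxD map_mxZ map_delta_mx addrA mulmxDr -scalemxAr -colE.
  by rewrite [LHS]mxE; congr (_ + _); rewrite !mxE.
have [ii0|ii0] := eqVneq i i0.
  by rewrite ii0 T1 mulr1 addrC.
have /= := ii0; rewrite -val_eqE /= => ne.
by rewrite T0 ?mulr0 ?addr0 ?zP//=; lia.
Qed.

Lemma det_int_unit p (U : 'M[int]_p) : U \in unitmx -> \det (rmx U) ^+ 2 = 1.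
Proof.
by rewrite unitmxE det_map_mx => /orP[] /eqP ->; rewrite ?rmorphN ?rmorph1 ?sqrrN expr1n.
Qed.

Lemma det_unitriangular p (T : 'M[R]_p) :
  (forall i j : 'I_p, (j < i)%N -> T i j = 0) -> (forall i, T i i = 1) ->
  \det T = 1.
Proof.
move=> T0 T1; rewrite -det_tr det_trig; first by apply: big1 => i _; rewrite mxE.
by apply/is_trig_mxP => i j ij; rewrite mxE T0.
Qed.

Lemma prodr_const_ord (p : nat) (x : R) : \prod_(i < p) x = x ^+ p.
Proof. by rewrite prodr_const card_ord. Qed.

Lemma prod_ge (I : finType) (a : I -> R) (d : R) : 0 <= d -> (forall i, d <= a i) ->
  forall i, a i * d ^+ #|I|.-1 <= \prod_j a j.
Proof.
move=> d0 da i; rewrite (bigD1 i)//= ler_wpM2l ?(le_trans d0)//.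
rewrite -(cardC1 i) -prodr_const; apply: ler_prod => j _.
by rewrite d0 da.
Qed.

Lemma prod_le (I : finType) (a : I -> R) (d : R) : (forall i, 0 <= a i <= d) ->
  forall i, \prod_j a j <= a i * d ^+ #|I|.-1.
Proof.
move=> ad i; rewrite (bigD1 i)//= ler_wpM2l//; first by case/andP: (ad i).
by rewrite -(cardC1 i) -prodr_const; apply: ler_prod => j _.
Qed.

Section Bounds.
Variables (p : nat) (G : 'M[R]_p).
Hypotheses (Gs : G^T = G) (Gc : coercive G) (p0 : (0 < p)%N).
Let q (x : 'cV[R]_p) := form G x x.
Let o := Ordinal p0.

(** In the basis [U] of the lattice the form is a sum of squares with weights
    [a_i]; these are increasing up to the factor [4 ^+ p] and play the part of
    the successive minima. *)
Definition profile (U : 'M[int]_p) (a : 'rV[R]_p) (T : 'M[R]_p) : Prop :=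
  [/\ U \in unitmx,
      (forall i, 0 < a 0 i) /\ (forall i j : 'I_p, (i <= j)%N -> a 0 i <= 4 ^+ p * a 0 j),
      (forall i j : 'I_p, (j < i)%N -> T i j = 0) /\ (forall i, T i i = 1),
      forall x, q (rmx U *m x) = \sum_i a 0 i * (T *m x) i 0 ^+ 2
    & \det G = \prod_i a 0 i].

Lemma reduced_profile : exists U a T, profile U a T.
Proof.
have [U [a [T [Uu aP [T0 T1] _ UE]]]] := reduction Gs Gc.
exists U, a, T; split => // [x|].
  by rewrite /q -form_congr UE form_congr form_diag.
have := congr1 determinant UE; rewrite !det_mulmx !det_tr det_diag.
rewrite (det_unitriangular T0 T1) mul1r mulr1 => <-.
by rewrite mulrAC -expr2 det_int_unit// mul1r.
Qed.

(** The weight [a_0] is the value of the form at the first basis vector. *)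
Lemma profile_ge_systole c U a T :
  (forall z : 'cV[int]_p, z != 0 -> c <= q (rmx z)) -> profile U a T ->
  forall i, c / 4 ^+ p <= a 0 i.
Proof.
move=> cP [Uu [a0 aP] [T0 T1] qE detE] i.
rewrite ler_pdivrMr ?exprn_gt0// mulrC; apply: le_trans (aP o i _) => //.
have -> : a 0 o = q (rmx (U *m delta_mx o 0)).
  rewrite map_mxM map_delta_mx qE -colE (bigD1 o)//= mxE T1 expr1n mulr1 big1 ?addr0//.
  move=> i' io; rewrite mxE T0 ?expr0n ?mulr0//= lt0n.
  by apply: contraNneq io => i0; apply/eqP/val_inj.
apply: cP; apply/negP => /eqP /(congr1 (mulmx (invmx U))); rewrite mulKmx // mulmx0.
by move/matrixP/(_ o 0); rewrite !mxE !eqxx.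
Qed.

Lemma det_ge_of_systole c : 0 < c ->
  (forall z : 'cV[int]_p, z != 0 -> c <= q (rmx z)) -> (c / 4 ^+ p) ^+ p <= \det G.
Proof.
move=> c0 cP; have [U [a [T prf]]] := reduced_profile.
have ca := profile_ge_systole cP prf; case: prf => _ _ _ _ ->.
rewrite -prodr_const_ord; apply: ler_prod => i _.
by rewrite ca divr_ge0 ?exprn_ge0// ltW.
Qed.

(** The point found by rounding has all its [T]-coordinates at most 1/2, so the form
    is at most the sum of the [a_i]; each of these is at most the determinant
    divided by a lower bound for the [p - 1] others. *)
Lemma covering_of_systole c M : 0 < c ->
  (forall z : 'cV[int]_p, z != 0 -> c <= q (rmx z)) -> \det G <= M ->
  forall w, exists z : 'cV[int]_p,
    q (w + rmx z) <= p%:R * (M / (c / 4 ^+ p) ^+ p.-1).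
Proof.
move=> c0 cP GM w; have [U [a [T prf]]] := reduced_profile.
have ca := profile_ge_systole cP prf.
case: prf => Uu [a0 aP] [T0 T1] qE detE.
have d0 : 0 < c / 4 ^+ p by rewrite divr_gt0 ?exprn_gt0.
have aM i : a 0 i <= M / (c / 4 ^+ p) ^+ p.-1.
  rewrite ler_pdivlMr ?exprn_gt0//; apply: le_trans GM; rewrite detE.
  by have := prod_ge (ltW d0) ca i; rewrite card_ord.
have [z zP] := nearest_plane (invmx (rmx U) *m w) T0 T1.
have rUu : rmx U \in unitmx by rewrite unitmxE det_map_mx rmorph_unit.
exists (U *m z).
have -> : w + rmx (U *m z) = rmx U *m (invmx (rmx U) *m w + rmx z).
  by rewrite mulmxDr mulKVmx// map_mxM.
rewrite qE -[p in p%:R]card_ord mulr_natl -sumr_const; apply: ler_sum => i _.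
apply: le_trans (aM i); rewrite ler_piMr ?(ltW (a0 i))// -real_normK ?num_real//.
by rewrite expr_le1 ?(le_trans (zP i))// invf_le1 // ler1n.
Qed.

(** The half of the last basis vector is a deep point: its last [T]-coordinate is
    a half-integer modulo the lattice, so the form is at least [a / 4] there, for
    the last weight [a], which dominates all the weights. *)
Lemma profile_le_covering (r : R) U a T :
  (forall w, exists z : 'cV[int]_p, q (w + rmx z) <= r) -> profile U a T ->
  forall i, a 0 i <= 4 ^+ p * (4 * r).
Proof.
move=> rP [Uu [a0 aP] [T0 T1] qE detE] i.
have lp : (p.-1 < p)%N by lia.
set l := Ordinal lp.
apply: le_trans (aP i l _) _; first by rewrite /= -ltnS prednK.
rewrite ler_pM2l ?exprn_gt0//.
have rUu : rmx U \in unitmx by rewrite unitmxE det_map_mx rmorph_unit.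
have [z] := rP (rmx U *m (2^-1 *: delta_mx l 0)).
have -> : rmx U *m (2^-1 *: delta_mx l 0) + rmx z =
    rmx U *m (2^-1 *: delta_mx l 0 + rmx (invmx U *m z)).
  by rewrite mulmxDr -map_mxM mulKVmx.
move: (invmx U *m z) => z'; rewrite qE (bigD1 l)//= => h.
have {h} : a 0 l * (2^-1 + (z' l 0)%:~R) ^+ 2 <= r.
  apply: le_trans h; rewrite -[leLHS]addr0 lerD//; last first.
    by apply: sumr_ge0 => j _; rewrite mulr_ge0 ?sqr_ge0// ltW.
  rewrite le_eqVlt; apply/orP; left; apply/eqP; congr (_ * _ ^+ 2).
  rewrite mxE (bigD1 l)//= T1 mul1r big1 ?addr0.
    by rewrite !mxE !eqxx mulr1.
  move=> j jl; rewrite T0 ?mul0r//=.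
  have := ltn_ord j; move: jl; rewrite -val_eqE /=; lia.
have : 4^-1 <= (2^-1 + (z' l 0)%:~R) ^+ 2 :> R.
  have [z0|z0] := leP 0 (z' l 0).
    have : 0 <= (z' l 0)%:~R :> R by rewrite ler0z.
    move=> h; nra.
  have : (z' l 0)%:~R <= -1 :> R by rewrite -[-1](rmorphN1 intr) ler_int; lia.
  move=> h; nra.
move=> /(ler_wpM2l (ltW (a0 l))); lra.
Qed.

Lemma det_le_of_covering r : (forall w, exists z : 'cV[int]_p, q (w + rmx z) <= r) ->
  \det G <= (4 ^+ p * (4 * r)) ^+ p.
Proof.
move=> rP; have [U [a [T prf]]] := reduced_profile.
have ar := profile_le_covering rP prf; case: prf => _ [a0 _] _ _ ->.
rewrite -prodr_const_ord; apply: ler_prod => i _.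
by rewrite ar ltW.
Qed.

(** If [k] is the last nonzero coordinate of a lattice vector in the basis [U], its
    [T]-coordinate [k] is a nonzero integer, so the form is at least [a_k]; this is
    at least the determinant divided by an upper bound for the [p - 1] other
    weights. *)
Lemma systole_of_covering r d : (forall w, exists z : 'cV[int]_p, q (w + rmx z) <= r) ->
  0 < d -> d <= \det G ->
  forall z : 'cV[int]_p, z != 0 -> d / (4 ^+ p * (4 * r)) ^+ p.-1 <= q (rmx z).
Proof.
move=> rP d0 dG; have [U [a [T prf]]] := reduced_profile.
have ar := profile_le_covering rP prf.
case: prf => Uu [a0 aP] [T0 T1] qE detE.
have R0 : 0 < 4 ^+ p * (4 * r) by apply: lt_le_trans (ar o).
have da i : d / (4 ^+ p * (4 * r)) ^+ p.-1 <= a 0 i.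
  rewrite ler_pdivrMr ?exprn_gt0//; apply: le_trans dG _; rewrite detE.
  have := @prod_le _ (a 0) (4 ^+ p * (4 * r)) _ i; rewrite card_ord; apply => j.
  by rewrite ltW ?ar.
move=> z z0; pose z' := invmx U *m z.
have zE : z = U *m z' by rewrite mulKVmx.
have [i zi] : exists i, z' i 0 != 0.
  by apply: cV_neq0; apply: contraNneq z0 => z'0; rewrite zE z'0 mulmx0.
case: (@arg_maxnP _ i (fun i => z' i 0 != 0) val zi) => k zk kmax.
rewrite zE map_mxM qE (bigD1 k)//= -[leLHS]addr0 lerD//; last first.
  by apply: sumr_ge0 => j _; rewrite mulr_ge0 ?sqr_ge0// ltW.
apply: le_trans (da k) _; rewrite ler_peMr ?(ltW (a0 k))//.
have -> : (T *m rmx z') k 0 = (z' k 0)%:~R.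
  rewrite mxE (bigD1 k)//= T1 mul1r big1 ?addr0 ?mxE//.
  move=> j jk; rewrite mxE; have [lt|gt|eq] := ltngtP j k.
  - by rewrite T0 ?mul0r.
  - have /negPn/eqP-> : ~~ (z' j 0 != 0) by apply: contraL gt => /kmax /=; rewrite leqNgt.
    by rewrite mulr0.
  - by move/val_inj: eq jk => ->; rewrite eqxx.
rewrite -rmorphXn/= ler1z -gtz0_ge1 lt_def sqr_ge0 andbT sqrf_eq0 //.
Qed.

End Bounds.
End LatticeInvariants.

(** * Eigenvalues of real skew-symmetric matrices *)

Section SkewSpectrum.
Local Open Scope sesquilinear_scope.
Context {R : realType}.
Local Notation C := R[i].
Local Notation cmx := (map_mx (real_complex R)).
Local Notation im := (fun t : R => Complex 0 t).

Lemma char_poly_similar (F : comUnitRingType) m (P A : 'M[F]_m) : P \in unitmx ->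
  char_poly (invmx P *m A *m P) = char_poly A.
Proof.
move=> Pu; rewrite /char_poly.
have -> : char_poly_mx (invmx P *m A *m P) =
    map_mx polyC (invmx P) *m char_poly_mx A *m map_mx polyC P.
  rewrite /char_poly_mx mulmxBr mulmxBl -!map_mxM scalar_mxC -(mulmxA _%:M).
  by rewrite -map_mxM mulVmx// map_mx1 mulmx1.
rewrite !det_mulmx mulrAC -det_mulmx -map_mxM mulVmx// map_mx1 det1 mul1r//.
Qed.

Lemma char_poly_tr (F : comUnitRingType) m (A : 'M[F]_m) : char_poly A^T = char_poly A.
Proof.
rewrite /char_poly -[RHS]det_tr; congr (\det _); apply/matrixP => i j.
by rewrite !mxE eq_sym.
Qed.

Lemma char_poly_diag (F : comUnitRingType) m (l : 'rV[F]_m) :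
  char_poly (diag_mx l) = \prod_i ('X - (l 0 i)%:P).
Proof.
rewrite char_poly_trig ?diag_mx_is_trig//.
by apply: eq_bigr => i _; rewrite mxE eqxx mulr1n.
Qed.

(** A real skew matrix is normal, hence unitarily diagonalizable over the complex
    numbers, and being skew-Hermitian it has eigenvalues opposite to their
    conjugates. *)
Lemma skew_diagonalization m (k : 'M[R]_m) : k^T = - k ->
  exists (P : 'M[C]_m) (t : 'I_m -> R), P \in unitmx /\
    cmx k = invmx P *m diag_mx (\row_i im (t i)) *m P.
Proof.
move=> kT.
have kct : (cmx k)^t* = - cmx k.
  rewrite map_trmx kT map_mxN; apply/matrixP => i j; rewrite !mxE.
  by apply/eqP; rewrite eq_complex /= ?oppr0 !eqxx.
have knorm : cmx k \is normalmx.
  by apply/normalmxP; rewrite kct mulmxN mulNmx.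
have /orthomx_spectral_subproof[[P l] /= Pu kE] := knorm.
have Pun : P \in unitmx by exact: unitarymx_unit.
have lE : diag_mx l = P *m cmx k *m invmx P.
  by rewrite kE !mulmxA mulmxV// mul1mx -mulmxA mulmxV// mulmx1.
have lct : (diag_mx l)^t* = - diag_mx l.
  rewrite lE invmx_unitary// !trmx_mul !map_mxM trmxCK kct.
  by rewrite mulNmx mulmxN mulmxA.
exists P, (fun i => complex.Im (l 0 i)); split; first exact: Pun.
suff <- : l = \row_i im (complex.Im (l 0 i)) by exact: kE.
apply/rowP => i; rewrite mxE.
have /matrixP/(_ i i) := lct; rewrite !mxE eqxx !mulr1n.
case: (l 0 i) => a b /eqP; rewrite eq_complex /= => /andP[/eqP ab _].
by congr (Complex _ _); lra.
Qed.

Lemma perm_opp_pairs (s : seq R) : perm_eq s (map -%R s) -> 0 \notin s ->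
  perm_eq s (seq.filter (fun t => 0 < t) s ++ map -%R (seq.filter (fun t => 0 < t) s)).
Proof.
move=> sN s0; set pos := fun t : R => 0 < t.
apply: (@perm_trans _ (seq.filter pos s ++ seq.filter (predC pos) s)).
  by rewrite perm_sym perm_filterC.
rewrite perm_cat2l /pos.
have -> : seq.filter (predC (fun t => 0 < t)) s = seq.filter (fun t => t < 0) s.
  apply: eq_in_filter => t ts /=; rewrite -leNgt le_eqVlt.
  by case: eqVneq => // t0; rewrite -t0 ts in s0.
apply: perm_trans (perm_filter _ sN) _.
rewrite filter_map; apply: perm_map.
by rewrite (eq_filter (a2 := pos)) => // t /=; rewrite oppr_lt0.
Qed.

Lemma prod_conj_pairs (s : seq R) :
  \prod_(t <- s) (('X - (im t)%:P) * ('X - (im (- t))%:P)) =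
  \prod_(x <- [seq im t | t <- s ++ map -%R s]) ('X - x%:P) :> {poly C}.
Proof. by rewrite big_map big_cat big_map big_split. Qed.

(** The characteristic polynomials of [k] and of [k^T = - k] agree, so the spectrum
    is symmetric about 0; it avoids 0 because [k] is invertible. The numbers [d] are
    the positive imaginary parts. *)
Lemma skew_eigenvalue_pairs n (k : 'M[R]_(n + n)) : k^T = - k -> k \in unitmx ->
  exists d : n.-tuple R, [/\ all (fun t => 0 < t) d, sorted <=%R d &
    char_poly (cmx k) = \prod_(t <- d) (('X - (im t)%:P) * ('X - (im (- t))%:P))].
Proof.
move=> kT ku; have [P [t [Pu kE]]] := skew_diagonalization kT.
set s := [seq t i | i <- index_enum 'I_(n + n)].
have cE : char_poly (cmx k) = \prod_(x <- [seq im t | t <- s]) ('X - x%:P).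
  rewrite kE char_poly_similar// char_poly_diag !big_map.
  by apply: eq_bigr => i _; rewrite mxE.
have cNE : char_poly (cmx k) = \prod_(x <- [seq im t | t <- map -%R s]) ('X - x%:P).
  rewrite -char_poly_tr map_trmx kT map_mxN kE -mulNmx -mulmxN char_poly_similar//.
  rewrite -raddfN char_poly_diag !big_map.
  apply: eq_bigr => i _; rewrite !mxE; congr ('X - _%:P).
  by apply/eqP; rewrite eq_complex /= oppr0 !eqxx.
have imI : injective im by move=> a b [].
have sN : perm_eq s (map -%R s).
  by apply: (perm_map_inj imI); apply: prod_XsubC_eq; rewrite -cE -cNE.
have s0 : 0 \notin s.
  apply/negP => /mapP[i _ ti].
  have : \det (cmx k) = 0.
    rewrite kE !det_mulmx det_diag (bigD1 i)//= mxE -ti.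
    by rewrite (_ : im 0 = 0)// mul0r mulr0 mul0r.
  rewrite det_map_mx => /eqP; rewrite fmorph_eq0 => /eqP k0.
  by move: ku; rewrite unitmxE k0 unitr0.
set e := seq.filter (fun t => 0 < t) s.
have sE : perm_eq s (e ++ map -%R e) by exact: perm_opp_pairs.
have ze : size (sort <=%R e) == n.
  have ss : size s = (n + n)%N by rewrite size_map [index_enum _]unlock -enumT size_enum_ord.
  have /perm_size := sE; rewrite size_cat (size_map _ e) ss size_sort => h.
  by apply/eqP; move: (size e) h => m; rewrite !addnn => /double_inj ->.
exists (Tuple ze); split => /=.
- by rewrite all_sort filter_all.
- exact/sort_sorted/le_total.
- rewrite cE prod_conj_pairs; apply: perm_big; apply: perm_map.
  apply: perm_trans sE _; apply: perm_cat; last apply: perm_map.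
    by rewrite perm_sym perm_sort.
  by rewrite perm_sym perm_sort.
Qed.

Lemma skew_eigenvalues n (k : 'M[R]_(n + n)) (s : seq R) : k^T = - k ->
  char_poly (cmx k) = \prod_(t <- s) (('X - (im t)%:P) * ('X - (im (- t))%:P)) ->
  \det k = \prod_(t <- s) t ^+ 2 /\ - \tr (k *m k) = 2 * \sum_(t <- s) t ^+ 2.
Proof.
move=> kT; have [P [t [Pu kE]]] := skew_diagonalization kT.
rewrite prod_conj_pairs.
have -> : char_poly (cmx k) =
    \prod_(x <- [seq im t | t <- [seq t i | i <- index_enum 'I_(n + n)]]) ('X - x%:P).
  rewrite kE char_poly_similar// char_poly_diag !big_map.
  by apply: eq_bigr => i _; rewrite mxE.
move=> /prod_XsubC_eq st; split; apply: (@complexI R).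
  rewrite -det_map_mx kE !det_mulmx mulrAC -det_mulmx mulVmx// det1 mul1r det_diag.
  transitivity (\prod_(x <- [seq im t | t <- [seq t i | i <- index_enum 'I_(n + n)]]) x).
    by rewrite !big_map; apply: eq_bigr => i _; rewrite mxE.
  rewrite (perm_big _ st) big_map big_cat /= big_map -big_split rmorph_prod /=.
  apply: eq_bigr => u _; apply/eqP; rewrite eq_complex /=.
  by apply/andP; split; apply/eqP; ring.
have -> : real_complex R (- \tr (k *m k)) = - \tr (cmx k *m cmx k).
  by rewrite -map_mxM rmorphN /= trace_map_mx.
rewrite kE -!mulmxA mulKVmx// mxtrace_mulC -!mulmxA mulmxV// mulmx1.
rewrite mulmx_diag mxtrace_diag.
transitivity (- \sum_(x <- [seq im t | t <- [seq t i | i <- index_enum 'I_(n + n)]]) x ^+ 2).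
  by congr (- _); rewrite !big_map; apply: eq_bigr => i _; rewrite !mxE.
rewrite (perm_big _ st) big_map big_cat /= big_map -big_split mulr_sumr rmorph_sum -sumrN /=.
apply: eq_bigr => u _; apply/eqP; rewrite eq_complex /=.
by apply/andP; split; apply/eqP; ring.
Qed.
End SkewSpectrum.

(** * Ricci curvature of a metric on a line bundle *)

Section QuadraticDerivative.
Context {R : realType}.

(** The coefficients of the metrics and their Christoffel symbols are polynomials
    of degree at most two along coordinate lines, so that their derivatives can be
    read off from the expansion. *)
Section Quadratic.
Variables (U V : normedModType R) (f : U -> V) (x v : U) (c1 c2 : V).
Hypothesis fE : forall h, f (h *: v + x) = f x + h *: c1 + h ^+ 2 *: c2.

Let quotient_cvg : (fun h => h^-1 *: ((f \o shift x) (h *: v) - f x)) @ 0^' --> c1.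
Proof.
have : c1 + h *: c2 @[h --> (0 : R)^'] --> c1.
  rewrite -[X in _ --> X]addr0 -(scale0r c2).
  apply: cvgD; first exact: cvg_cst.
  by apply: cvgZr_tmp; exact: cvg_within.
apply: cvg_trans; apply: near_eq_cvg.
near=> h; have h0 : h != 0 by near: h; exact: nbhs_dnbhs_neq.
rewrite /= fE -(addrA (f x)) [_ - f x]addrC addKr.
by rewrite scalerDr !scalerA mulVf// scale1r expr2 mulrA mulVf// mul1r.
Unshelve. all: by end_near. Qed.

Lemma derivable_quadratic : derivable f x v.
Proof. by apply/cvg_ex; exists c1. Qed.

Lemma derive_quadratic : 'D_v f x = c1.
Proof. exact: cvg_lim. Qed.

End Quadratic.

End QuadraticDerivative.

(** Metrics [g = S + s *: (alpha *m alpha^T)], where [S] is degenerate in the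
    direction [ez] and [alpha] is a covector field with affine coefficients whose
    differential is [J] up to sign: the metric of a line bundle over the flat space
    [S] with a connection of constant curvature. The matrix [E] is the curvature
    with one index raised by [S]. The inverse of [g] is needed only through
    [W], which is [g^-1 *m ((s / 2) *: J)]. *)
Section BundleMetric.
Context {R : realType} {N : nat}.
Variables (J E S : 'M[R]_N) (z : 'I_N) (s : R).
Local Notation ez := (delta_mx z 0 : 'cV[R]_N).
Hypotheses (JT : J^T = - J) (Jz : J *m ez = 0) (Sz : S *m ez = 0).
Hypotheses (SE : S *m E = J) (zE : ez^T *m E = 0) (Ez : E *m ez = 0) (trE : \tr E = 0).

Let alpha (x : 'cV[R]_N) : 'cV[R]_N := ez + 2^-1 *: (J *m x).
Let g (x : 'cV[R]_N) : 'M[R]_N := S + s *: (alpha x *m (alpha x)^T).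
Hypothesis gu : forall x, g x \in unitmx.
Let W x : 'M[R]_N := (s / 2) *: (E - ez *m ((2^-1 *: (J *m x))^T *m E)).

Lemma alpha_shift h k x : alpha (h *: delta_mx k 0 + x) = alpha x + h *: (2^-1 *: col k J).
Proof.
rewrite /alpha mulmxDr -scalemxAr -colE scalerDr !scalerA [h * _]mulrC.
by rewrite [_ *: col _ _ + _]addrC addrA.
Qed.

Lemma mulmx_zJ : ez^T *m J = 0.
Proof. by rewrite -[J]trmxK JT -trmx_mul mulNmx Jz oppr0 trmx0. Qed.

Lemma mulmx_alphaW x : (alpha x)^T *m W x = 0.
Proof.
rewrite /W; set b := 2^-1 *: (J *m x).
have zz : ez^T *m ez = 1%:M.
  by rewrite trmx_delta mul_delta_mx; apply/matrixP => i j; rewrite !mxE !ord1 eqxx.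
have bz : b^T *m ez = 0.
  by rewrite linearZ/= -scalemxAl trmx_mul JT -mulmxA mulNmx Jz oppr0 mulmx0 scaler0.
rewrite [(alpha x)^T](linearD _ ez b) -scalemxAr mulmxBr mulmxA !mulmxDl zE zz bz.
by rewrite add0r mul0mx addr0 mul1mx subrr scaler0.
Qed.

Lemma mulmx_gW x : g x *m W x = (s / 2) *: J.
Proof.
rewrite /g mulmxDl -scalemxAl -mulmxA mulmx_alphaW mulmx0 scaler0 addr0.
by rewrite /W -scalemxAr mulmxBr SE mulmxA Sz mul0mx subr0.
Qed.

Lemma J_antisym i j : J i j = - J j i.
Proof. by have /matrixP/(_ j i) := JT; rewrite !mxE. Qed.

Lemma pderiv_metric k i j x : pderiv k (fun y => g y i j) x =
  s / 2 * (J i k * alpha x j 0 + alpha x i 0 * J j k).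
Proof.
apply: (@derive_quadratic _ _ _ _ _ _ _ (s / 4 * (J i k * J j k))) => h.
rewrite /= /g alpha_shift.
move: (alpha x) => a; rewrite !mxE !big_ord1 !mxE /GRing.scale /=; by field.
Qed.

(** The derivatives of [alpha] are antisymmetric, so in the formula of Koszul the
    derivatives of [alpha] along [i] and [j] with the other index in [i, j] cancel;
    what is left is [alpha] times [J], with an index raised by [g]. *)
Lemma christoffelE l i j x :
  christoffel g l i j x = alpha x j 0 * W x l i + alpha x i 0 * W x l j.
Proof.
rewrite /christoffel.
under eq_bigr => m _.
  rewrite !pderiv_metric.
  have -> : forall t, t * (s / 2 * (J j i * alpha x m 0 + alpha x j 0 * J m i) +
      s / 2 * (J i j * alpha x m 0 + alpha x i 0 * J m j) -
      s / 2 * (J i m * alpha x j 0 + alpha x i 0 * J j m)) =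
      t * (2 * alpha x j 0 * ((s / 2) *: J) m i + 2 * alpha x i 0 * ((s / 2) *: J) m j).
    by move=> t; rewrite !mxE (J_antisym j i) (J_antisym i m) (J_antisym j m); ring.
  rewrite mulrDr !(mulrCA (invmx _ _ _)).
  over.
rewrite big_split /= -!mulr_sumr.
have sumW c : \sum_m invmx (g x) l m * ((s / 2) *: J) m c = W x l c.
  transitivity ((invmx (g x) *m ((s / 2) *: J)) l c); first by rewrite [RHS]mxE.
  by rewrite -(mulmx_gW x) mulKmx.
by rewrite !sumW; field.
Qed.

Let Q : 'M[R]_N := J^T *m E.

Lemma pderiv_christoffel i l j k x : pderiv i (christoffel g l j k) x =
  2^-1 * J k i * W x l j - alpha x k 0 * (s / 4) * (l == z)%:R * Q i j +
  (2^-1 * J j i * W x l k - alpha x j 0 * (s / 4) * (l == z)%:R * Q i k).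
Proof.
have -> : christoffel g l j k = fun x => alpha x k 0 * W x l j + alpha x j 0 * W x l k.
  by apply/funext => y; rewrite christoffelE.
have WE h m : W (h *: delta_mx i 0 + x) l m = W x l m - h * ((s / 4) * (l == z)%:R * Q i m).
  rewrite /W mulmxDr -scalemxAr -colE.
  have -> : (2^-1 *: (h *: col i J + J *m x))^T *m E =
     (2^-1 *: (J *m x))^T *m E + h / 2 *: row i Q.
    rewrite scalerDr linearD mulmxDl addrC; congr (_ + _).
    by rewrite scalerA linearZ /= -scalemxAl tr_col -row_mul mulrC.
  rewrite mulmxDr opprD addrA scalerDr -scalemxAr.
  rewrite [LHS]mxE; congr (_ + _); rewrite !mxE big_ord1 !mxE eqxx andbT; by field.
have aE h m : alpha (h *: delta_mx i 0 + x) m 0 = alpha x m 0 + h * (2^-1 * J m i).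
  by rewrite alpha_shift !mxE.
clearbody W alpha Q.
apply: (@derive_quadratic _ _ _ _ _ _ _
  (- (2^-1 * J k i * (s / 4) * (l == z)%:R * Q i j) - (2^-1 * J j i * (s / 4) * (l == z)%:R * Q i k))) => h.
rewrite (WE h j) (WE h k) !aE /GRing.scale /=.
by ring.
Qed.

Lemma W_vertical x : W x *m ez = 0.
Proof. by rewrite /W -scalemxAl mulmxBl -!mulmxA Ez !mulmx0 subr0 scaler0. Qed.

Lemma mxtrace_W x : \tr (W x) = 0.
Proof.
rewrite /W mxtraceZ linearB /= trE mxtrace_mulC -mulmxA Ez mulmx0 mxtrace0.
by rewrite subr0 mulr0.
Qed.

Lemma mxtrace_WW x : \tr (W x *m W x) = s ^+ 2 / 4 * \tr (E *m E).
Proof.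
have -> : W x *m W x = (s / 2) *: (W x *m E).
  by rewrite {2}/W -scalemxAr mulmxBr [W x *m (_ *m _)]mulmxA W_vertical mul0mx subr0.
rewrite mxtraceZ /W -scalemxAl mxtraceZ mulmxBl linearB /= -!mulmxA.
rewrite [\tr (_ *m (_ *m _))]mxtrace_mulC -!mulmxA Ez !mulmx0 mxtrace0 subr0.
by field.
Qed.

Lemma mulmx_JW x : J *m W x = - (s / 2) *: Q.
Proof.
rewrite /W /Q -scalemxAr mulmxBr mulmxA Jz mul0mx subr0 JT mulNmx.
by rewrite scalerN scaleNr opprK.
Qed.

Lemma Q_col_z i : Q i z = 0.
Proof.
have <- : (Q *m ez) i 0 = Q i z by rewrite -colE mxE.
by rewrite /Q -mulmxA Ez mulmx0 mxE.
Qed.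

Lemma Q_row_z i : Q z i = 0.
Proof.
have <- : (ez^T *m Q) 0 i = Q z i by rewrite trmx_delta -rowE mxE.
by rewrite /Q mulmxA -trmx_mul Jz trmx0 mul0mx mxE.
Qed.

Lemma alpha_z x : alpha x z 0 = 1.
Proof.
have <- : (ez^T *m alpha x) 0 0 = alpha x z 0 by rewrite trmx_delta -rowE mxE.
rewrite /alpha mulmxDr -scalemxAr mulmxA mulmx_zJ mul0mx scaler0 addr0.
by rewrite trmx_delta mul_delta_mx mxE !eqxx.
Qed.

(** The matrix [W] has trace zero and is killed by [alpha] on the left, so the only
    quadratic term that survives the contraction is the trace of [W *m W] times
    [alpha *m alpha^T]; the derivative terms contribute the multiple of [Q + Q^T]. *)
Lemma ricciE x : ricci g x =
  - (s / 4) *: (Q + Q^T) - (s ^+ 2 / 4 * \tr (E *m E)) *: (alpha x *m (alpha x)^T).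
Proof.
have sumJW k j : \sum_i J k i * W x i j = - (s / 2) * Q k j.
  by transitivity ((J *m W x) k j); [rewrite [RHS]mxE|rewrite mulmx_JW mxE].
have sumaW j : \sum_i alpha x i 0 * W x i j = 0.
  transitivity (((alpha x)^T *m W x) 0 j); last by rewrite mulmx_alphaW mxE.
  by rewrite [RHS]mxE; apply: eq_bigr => i _; rewrite [(alpha x)^T _ _]mxE.
have sumW : \sum_i W x i i = 0 by rewrite -[RHS](mxtrace_W x).
have sumWW : \sum_i \sum_m W x m i * W x i m = s ^+ 2 / 4 * \tr (E *m E).
  rewrite -(mxtrace_WW x) exchange_big; apply: eq_bigr => i _; rewrite [RHS]mxE.
  by apply: eq_bigr => m _.
have az := alpha_z x; have Qz1 := Q_col_z; have zQ1 := Q_row_z; have J1 := J_antisym.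
have P1 j k : \sum_i pderiv i (christoffel g i j k) x = - (s / 4) * (Q k j + Q j k).
  rewrite (eq_bigr _ (fun i _ => pderiv_christoffel i i j k x)).
  clearbody W alpha Q.
  rewrite big_split !sumrB /=.
  have z0 a u : \sum_i a * (s / 4) * (i == z)%:R * Q i u = 0.
    apply: big1 => i _; case: eqVneq => [->|_]; first by rewrite zQ1 mulr0.
    by rewrite mulr0 mul0r.
  rewrite !z0 !subr0.
  under eq_bigr do rewrite -mulrA.
  under [X in _ + X]eq_bigr do rewrite -mulrA.
  rewrite -!mulr_sumr !sumJW; by field.
have P2 j k : \sum_i pderiv j (christoffel g i i k) x = 0.
  rewrite (eq_bigr _ (fun i _ => pderiv_christoffel j i i k x)).
  clearbody W alpha Q.
  rewrite big_split !sumrB /=.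
  have -> : \sum_i alpha x k 0 * (s / 4) * (i == z)%:R * Q j i = 0.
    apply: big1 => i _; case: eqVneq => [->|_]; first by rewrite Qz1 mulr0.
    by rewrite mulr0 mul0r.
  have -> : \sum_i alpha x i 0 * (s / 4) * (i == z)%:R * Q j k = s / 4 * Q j k.
    rewrite (bigD1 z)//= az eqxx big1 ?addr0; first by rewrite mulr1 mul1r.
    by move=> i /negPf ->; rewrite mulr0 mul0r.
  rewrite -mulr_sumr sumW.
  have -> : \sum_i 2^-1 * J i j * W x i k = - 2^-1 * \sum_i J j i * W x i k.
    by rewrite mulr_sumr; apply: eq_bigr => i _; rewrite (J1 i j); ring.
  rewrite sumJW; by field.
have P3 j k : \sum_i \sum_m (christoffel g m j k x * christoffel g i i m x
                  - christoffel g m i k x * christoffel g i j m x) =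
    - (s ^+ 2 / 4 * \tr (E *m E)) * (alpha x j 0 * alpha x k 0).
  transitivity (\sum_i \sum_m ((alpha x k 0 * W x m j + alpha x j 0 * W x m k) *
      (alpha x m 0 * W x i i + alpha x i 0 * W x i m) -
      (alpha x k 0 * W x m i + alpha x i 0 * W x m k) *
      (alpha x m 0 * W x i j + alpha x j 0 * W x i m))).
    by apply: eq_bigr => i _; apply: eq_bigr => m _; rewrite !christoffelE.
  rewrite -sumWW; move: (W x) (alpha x) sumaW sumW => w a sumaW sumW.
  transitivity (\sum_i \sum_m ((a k 0 * (a m 0 * w m j) + a j 0 * (a m 0 * w m k)) * w i i +
      (a k 0 * w m j + a j 0 * w m k) * (a i 0 * w i m)) -
      \sum_i \sum_m (a k 0 * w i j * (a m 0 * w m i) + a i 0 * w i j * (a m 0 * w m k)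
         + a j 0 * w m k * (a i 0 * w i m) + a k 0 * a j 0 * (w m i * w i m))).
    rewrite -sumrB; apply: eq_bigr => i _; rewrite -sumrB; apply: eq_bigr => m _.
    by ring.
  have s1 : \sum_i \sum_m ((a k 0 * (a m 0 * w m j) + a j 0 * (a m 0 * w m k)) * w i i +
      (a k 0 * w m j + a j 0 * w m k) * (a i 0 * w i m)) = 0.
    under eq_bigr => i _.
      rewrite big_split /= -mulr_suml big_split /= -!mulr_sumr !sumaW !mulr0 addr0 mul0r add0r.
      over.
    rewrite exchange_big; apply: big1 => m _ /=.
    by rewrite -mulr_sumr sumaW mulr0.
  have s2 : \sum_i \sum_m (a k 0 * w i j * (a m 0 * w m i)) = 0.
    by apply: big1 => i _; rewrite -mulr_sumr sumaW mulr0.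
  have s3 : \sum_i \sum_m (a i 0 * w i j * (a m 0 * w m k)) = 0.
    by apply: big1 => i _; rewrite -mulr_sumr sumaW mulr0.
  have s4 : \sum_i \sum_m (a j 0 * w m k * (a i 0 * w i m)) = 0.
    by rewrite exchange_big; apply: big1 => m _ /=; rewrite -mulr_sumr sumaW mulr0.
  rewrite s1 sub0r mulNr; congr (- _).
  under eq_bigr do rewrite !big_split /=.
  rewrite !big_split /= s2 s3 s4 !add0r mulr_suml; apply: eq_bigr => i _.
  by rewrite mulr_suml; apply: eq_bigr => m _; ring.
apply/matrixP => j k.
have -> : ricci g x j k = \sum_i pderiv i (christoffel g i j k) x -
    \sum_i pderiv j (christoffel g i i k) x +
    \sum_i \sum_m (christoffel g m j k x * christoffel g i i m x
                  - christoffel g m i k x * christoffel g i j m x).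
  by rewrite -sumrB -big_split mxE.
rewrite [X in X - _ + _]P1 [X in _ - X + _]P2 [X in _ + X]P3.
clear P1 P2 P3.
have -> : (- (s / 4) *: (Q + Q^T) - (s ^+ 2 / 4 * \tr (E *m E)) *: (alpha x *m (alpha x)^T)) j k =
   - (s / 4) * (Q j k + Q k j) - (s ^+ 2 / 4 * \tr (E *m E)) * (alpha x j 0 * alpha x k 0).
  clearbody Q alpha; move: (s ^+ 2 / 4 * \tr (E *m E)) => c.
  by rewrite !(mxE, big_ord1).
by move: (\tr _) (Q j k) (Q k j) (alpha x) => tE q1 q2 a; ring.
Qed.
End BundleMetric.

(** * The left invariant metrics *)

Section HeisenbergMetric.
Context {R : realType} {n : nat}.
Local Notation v := 'cV[R]_(n + n).
Local Notation h := 'cV[R]_(n + n + 1).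
Local Notation J := (@Jmx R n).
Local Notation ez := (delta_mx iZ 0 : h).
Implicit Types (A : 'M[R]_(n + n) * R) (x y u w : h).

Definition Jext : 'M[R]_(n + n + 1) := block_mx J 0 0 0.
Definition gram A : 'M[R]_(n + n) := (invmx A.1)^T *m invmx A.1.
(** The differential at [x] of the left translation by the inverse of [x]. *)
Definition left_mx (x : h) : 'M[R]_(n + n + 1) :=
  1%:M + ez *m (2^-1 *: (Jext *m x))^T.

Lemma tr_Jmx : J^T = - J.
Proof.
by rewrite /Jmx tr_block_mx !trmx0 linearN /= !trmx1 opp_block_mx !oppr0 opprK.
Qed.

Lemma mul_Jmx_tr : J *m J^T = 1%:M.
Proof.
rewrite /Jmx tr_block_mx !trmx0 linearN /= !trmx1 mulmx_block.
by rewrite !mulmx0 !mul0mx !mulmx1 mulNmx mulmxN mul1mx opprK !add0r !addr0 -scalar_mx_block.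
Qed.

Lemma ezE : ez = col_mx 0 1%:M.
Proof.
apply/matrixP => i j; rewrite [LHS]mxE; case: (split_ordP i) => k ->.
  by rewrite col_mxEu mxE -val_eqE /= !ord1 ltn_eqF //= addn0.
by rewrite col_mxEd mxE !ord1 !eqxx.
Qed.

Lemma tr_Jext : Jext^T = - Jext.
Proof. by rewrite /Jext tr_block_mx !trmx0 tr_Jmx (opp_block_mx J 0 0 0) !oppr0. Qed.

Lemma Jext_z : Jext *m ez = 0.
Proof. by rewrite ezE /Jext mul_block_col !mul0mx mulmx0 !addr0 col_mx0. Qed.

Lemma form_block m1 m2 (S1 : 'M[R]_m1) (S2 : 'M[R]_m2) (x y : 'cV[R]_(m1 + m2)) :
  form (block_mx S1 0 0 S2) x y = form S1 (usubmx x) (usubmx y) + form S2 (dsubmx x) (dsubmx y).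
Proof.
rewrite /form -{1}[x]vsubmxK -{1}[y]vsubmxK tr_col_mx mul_row_block !mulmx0 addr0 add0r.
by rewrite mul_row_col mxE.
Qed.

Lemma form0 m (x y : 'cV[R]_m) : form 0 x y = 0.
Proof. by rewrite /form mulmx0 mul0mx mxE. Qed.

Lemma form_J (a b : v) : form J a b =
  \sum_(i < n) (a (lshift n i) 0 * b (rshift n i) 0 - a (rshift n i) 0 * b (lshift n i) 0).
Proof.
rewrite /form -{1}[a]vsubmxK -{1}[b]vsubmxK tr_col_mx mul_row_block !mulmx0 addr0 add0r.
rewrite mulmx1 mulmxN mulmx1 mul_row_col !mxE -big_split /=.
by apply: eq_bigr => i _; rewrite !mxE addrC mulNr.
Qed.

Lemma bracketE x y : bracket x y = form Jext x y *: ez.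
Proof.
rewrite /Jext form_block form0 addr0 form_J /bracket; congr (_ *: _).
by apply: eq_bigr => i _; rewrite !mxE.
Qed.

Lemma form_Jext x y : form Jext x y = form J (usubmx x) (usubmx y).
Proof. by rewrite form_block form0 addr0. Qed.

Lemma formDr m (G : 'M[R]_m) (a b c : 'cV[R]_m) : form G a (b + c) = form G a b + form G a c.
Proof. by rewrite /form mulmxDr mxE. Qed.

Lemma formDl m (G : 'M[R]_m) (a b c : 'cV[R]_m) : form G (a + b) c = form G a c + form G b c.
Proof. by rewrite /form linearD /= !mulmxDl mxE. Qed.

Lemma formZr m (G : 'M[R]_m) (t : R) (a b : 'cV[R]_m) : form G a (t *: b) = t * form G a b.
Proof. by rewrite /form -scalemxAr mxE. Qed.

Lemma formZl m (G : 'M[R]_m) (t : R) (a b : 'cV[R]_m) : form G (t *: a) b = t * form G a b.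
Proof. by rewrite /form linearZ /= -!scalemxAl mxE. Qed.

Lemma formNl m (G : 'M[R]_m) (a b : 'cV[R]_m) : form G (- a) b = - form G a b.
Proof. by rewrite -scaleN1r formZl mulN1r. Qed.

Lemma form_skew m (G : 'M[R]_m) (a b : 'cV[R]_m) : G^T = - G -> form G a b = - form G b a.
Proof.
move=> GT; have <- : ((a^T *m G *m b)^T) 0 0 = form G a b by rewrite mxE.
by rewrite !trmx_mul trmxK GT mulNmx mulmxN mulmxA mxE.
Qed.

Lemma form_skew0 m (G : 'M[R]_m) (a : 'cV[R]_m) : G^T = - G -> form G a a = 0.
Proof. by move=> /(form_skew a a) ?; lra. Qed.

Lemma left_mxE x u : left_mx x *m u = u - 2^-1 *: bracket x u.
Proof.
rewrite /left_mx mulmxDl mul1mx bracketE; congr (_ + _).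
rewrite linearZ /= trmx_mul tr_Jext mulmxN scalerN mulmxN mulNmx -scalemxAr -scalemxAl -mulmxA.
rewrite [_ *m u]mx11_scalar mul_mx_scalar.
by rewrite /form.
Qed.

Lemma to_identityE x u : to_identity x u = left_mx x *m u.
Proof.
rewrite left_mxE; apply: (@derive_quadratic _ _ _ _ _ _ _ 0) => t.
rewrite scaler0 addr0 /hmul /hinv !bracketE !formNl !formDr formZr form_skew0 ?tr_Jext//.
rewrite !addr0 oppr0 scale0r scaler0 addr0 scalerBr !scalerA addNr.
rewrite add0r; congr (_ + _); first by rewrite addrC addrK.
by rewrite -scaleNr; congr (_ *: _); ring.
Qed.

(** The left invariant covector that is 1 on Z and 0 on v. *)
Definition alpha (x : h) : h := ez + 2^-1 *: (Jext *m x).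

Lemma block_inv A : GLR A ->
  invmx (blockmx A) = block_mx (invmx A.1) 0 0 (A.2^-1)%:M.
Proof.
move=> [Bu r0]; have inv : blockmx A *m block_mx (invmx A.1) 0 0 (A.2^-1)%:M = 1%:M.
  rewrite /blockmx mulmx_block !mulmx0 !mul0mx !addr0 add0r mulmxV//.
  by rewrite -scalar_mxM divff// -scalar_mx_block.
have [Au _] := mulmx1_unit inv.
by rewrite -[RHS](mulKmx Au) inv mulmx1.
Qed.

Definition full_gram A := (invmx (blockmx A))^T *m invmx (blockmx A).

Lemma inner_form A x y : inner A x y = form (full_gram A) x y.
Proof. by rewrite /inner /inner0 /form /full_gram trmx_mul !mulmxA. Qed.

Lemma innerE A x y : GLR A ->
  inner A x y = form (gram A) (usubmx x) (usubmx y) + A.2 ^- 2 * (x iZ 0 * y iZ 0).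
Proof.
move=> GA; rewrite inner_form /full_gram block_inv// tr_block_mx !trmx0.
rewrite mulmx_block !mulmx0 !mul0mx !addr0 add0r.
rewrite form_block; congr (_ + _).
rewrite tr_scalar_mx -scalar_mxM /form mul_mx_scalar -scalemxAl !mxE big_ord1 !mxE.
by rewrite expr2 invfM.
Qed.

Lemma left_mx_v x u : usubmx (left_mx x *m u) = usubmx u.
Proof.
by rewrite left_mxE bracketE scalerA ezE linearB linearZ /= col_mxKu scaler0 subr0.
Qed.

Lemma left_mx_z x u : (left_mx x *m u) iZ 0 = ((alpha x)^T *m u) 0 0.
Proof.
have <- : (ez^T *m (left_mx x *m u)) 0 0 = (left_mx x *m u) iZ 0.
  by rewrite trmx_delta -rowE mxE.
rewrite mulmxA; congr ((_ *m _) _ _).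
rewrite /left_mx mulmxDr mulmx1 mulmxA trmx_delta mul_delta_mx /alpha linearD /= trmx_delta.
have -> : delta_mx 0 0 = 1%:M :> 'M[R]_1 by apply/matrixP => i j; rewrite !mxE !ord1.
by rewrite mul1mx.
Qed.

Lemma metric_congr A x : metric A x = (left_mx x)^T *m full_gram A *m left_mx x.
Proof.
apply/matrixP => i j; rewrite mxE !to_identityE inner_form.
by rewrite -form_congr form_delta.
Qed.

Lemma form_metric A x u w :
  form (metric A x) u w = inner A (left_mx x *m u) (left_mx x *m w).
Proof. by rewrite metric_congr form_congr inner_form. Qed.

Lemma form_metricE A x u w : GLR A ->
  form (metric A x) u w = form (gram A) (usubmx u) (usubmx w) +
    A.2 ^- 2 * (((alpha x)^T *m u) 0 0 * ((alpha x)^T *m w) 0 0).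
Proof. by move=> GA; rewrite form_metric innerE// !left_mx_v !left_mx_z. Qed.

Lemma metricE A x : GLR A ->
  metric A x = block_mx (gram A) 0 0 0 + A.2 ^- 2 *: (alpha x *m (alpha x)^T).
Proof.
move=> GA; apply/matrixP => i j; rewrite -form_delta form_metricE// [RHS]mxE.
rewrite -!colE ![col _ _ _ _]mxE; congr (_ + _).
  by rewrite -form_delta form_block form0 addr0.
by rewrite !(mxE, big_ord1).
Qed.

Lemma det_left_mx x : \det (left_mx x) = 1.
Proof.
have -> : left_mx x = block_mx 1%:M 0 (2^-1 *: (J *m usubmx x))^T 1%:M.
  rewrite /left_mx ezE -[x]vsubmxK /Jext mul_block_col !mul0mx !addr0 vsubmxK.
  rewrite scale_col_mx scaler0 tr_col_mx trmx0 mul_col_row mul0mx mul1mx mulmx0.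
  by rewrite scalar_mx_block add_block_mx mulmx0 !addr0 add0r.
by rewrite det_lblock !det1 mulr1.
Qed.

Lemma det_metric A x : GLR A -> \det (metric A x) = (\det A.1 * A.2) ^- 2.
Proof.
move=> GA; rewrite metric_congr /full_gram !det_mulmx !det_tr det_left_mx mul1r mulr1 -expr2.
rewrite det_inv exprVn; congr ((_ ^+ 2)^-1).
by rewrite /blockmx det_ublock det_scalar1.
Qed.

(** Conjugate to the transpose of [j_A]. *)
Definition skew A : 'M[R]_(n + n) := A.1^T *m J *m A.1.

Lemma tr_skew A : (skew A)^T = - skew A.
Proof. by rewrite /skew !trmx_mul trmxK tr_Jmx mulNmx mulmxN mulmxA. Qed.

Lemma trace_skew m (S K : 'M[R]_m) : S^T = S -> K^T = - K -> \tr (S *m K) = 0.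
Proof.
move=> ST KT; have : \tr (S *m K) = - \tr (S *m K).
  by rewrite -{1}mxtrace_tr trmx_mul ST KT mulNmx linearN /= mxtrace_mulC.
by move=> ?; lra.
Qed.

Lemma ricci_metricE A x : GLR A -> let E := block_mx (A.1 *m A.1^T *m J) 0 0 0 in
  ricci (metric A) x = - (A.2 ^- 2 / 4) *: (Jext^T *m E + (Jext^T *m E)^T)
    - ((A.2 ^- 2) ^+ 2 / 4 * \tr (skew A *m skew A)) *: (alpha x *m (alpha x)^T).
Proof.
move=> GA E; have [Bu r0] := GA.
have Ez : E *m ez = 0.
  by rewrite ezE /E mul_block_col !mul0mx mulmx0 !addr0 col_mx0.
have gE : metric A = fun y => block_mx (gram A) 0 0 0 + A.2 ^- 2 *: ((ez + 2^-1 *: (Jext *m y)) *m (ez + 2^-1 *: (Jext *m y))^T).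
  by apply/funext => y; rewrite metricE.
have -> : \tr (skew A *m skew A) = \tr (E *m E).
  rewrite /E mulmx_block !mulmx0 !mul0mx !addr0 mxtrace_block mxtrace0 addr0.
  rewrite /skew -!mulmxA mxtrace_mulC !mulmxA [in RHS]mxtrace_mulC !mulmxA.
  by rewrite [LHS]mxtrace_mulC [RHS]mxtrace_mulC !mulmxA.
rewrite gE; apply: (@ricciE _ _ Jext E (block_mx (gram A) 0 0 0) iZ) => //.
- exact: tr_Jext.
- exact: Jext_z.
- by rewrite ezE mul_block_col !mul0mx mulmx0 !addr0 col_mx0.
- rewrite /E mulmx_block !mulmx0 !mul0mx !addr0 /gram !mulmxA -(mulmxA _ (invmx _)) mulVmx//.
  by rewrite mulmx1 -trmx_mul mulmxV// trmx1 mul1mx.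
- by rewrite ezE tr_col_mx trmx0 /E mul_row_block !mul0mx !mulmx0 !addr0 row_mx0.
- rewrite /E mxtrace_block mxtrace0 addr0; apply: trace_skew; last exact: tr_Jmx.
  by rewrite trmx_mul trmxK.
- move=> y; rewrite -[X in X \in _](metricE y GA) unitmxE det_metric// unitfE invr_eq0.
  by rewrite expf_neq0// mulf_neq0// -unitfE -unitmxE.
Qed.

Lemma form_tr_mul m p (P : 'M[R]_(p, m)) (x : 'cV[R]_m) :
  form (P^T *m P) x x = \sum_i (P *m x) i 0 ^+ 2.
Proof.
rewrite /form mulmxA -trmx_mul -mulmxA mxE.
by apply: eq_bigr => i _; rewrite mxE expr2.
Qed.

Lemma form_gramE A (u : 'cV[R]_(n + n)) :
  form (gram A) u u = \sum_i (invmx A.1 *m u) i 0 ^+ 2.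
Proof. exact: form_tr_mul. Qed.

Lemma form_mxD m (G H : 'M[R]_m) (a b : 'cV[R]_m) : form (G + H) a b = form G a b + form H a b.
Proof. by rewrite /form mulmxDr mulmxDl mxE. Qed.

Lemma form_mxZ m (G : 'M[R]_m) (t : R) (a b : 'cV[R]_m) : form (t *: G) a b = t * form G a b.
Proof. by rewrite /form -scalemxAr -scalemxAl mxE. Qed.

Lemma form_mxT m (G : 'M[R]_m) (a : 'cV[R]_m) : form G^T a a = form G a a.
Proof.
have <- : ((a^T *m G *m a)^T) 0 0 = form G a a by rewrite mxE.
by rewrite !trmx_mul trmxK mulmxA.
Qed.

Lemma form_rank1 m (a u : 'cV[R]_m) : form (a *m a^T) u u = (a^T *m u) 0 0 ^+ 2.
Proof.
rewrite /form mulmxA -mulmxA mxE big_ord1 expr2; congr (_ * _).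
by rewrite -[in LHS](trmxK a) -trmx_mul mxE.
Qed.

Lemma trace_skew_sqr m (K : 'M[R]_m) : K^T = - K -> \tr (K *m K) = - \sum_i \sum_j K i j ^+ 2.
Proof.
move=> KT; rewrite -[X in X *m K]opprK -KT mulNmx linearN /=; congr (- _).
rewrite exchange_big; apply: eq_bigr => i _; rewrite mxE.
by apply: eq_bigr => j _; rewrite mxE expr2.
Qed.

(** In the frame of the columns of [A.1], orthonormal modulo Z, the first term is
    that of the vector [skew A *m w]. The curvature is thus nonpositive on v and
    nonnegative along Z. *)
Lemma form_ricci A x u : GLR A ->
  form (ricci (metric A) x) u u =
  - (A.2 ^- 2 / 2) * (\sum_i (skew A *m (invmx A.1 *m usubmx u)) i 0 ^+ 2)
  + (A.2 ^- 2) ^+ 2 / 4 * (\sum_i \sum_j skew A i j ^+ 2) * ((alpha x)^T *m u) 0 0 ^+ 2.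
Proof.
move=> GA; have [Bu _] := GA; rewrite ricci_metricE//.
rewrite form_mxD -[X in _ + form X _ _]scaleNr !form_mxZ form_mxD form_mxT form_rank1.
rewrite trace_skew_sqr ?tr_skew//.
have -> : form (Jext^T *m block_mx (A.1 *m A.1^T *m J) 0 0 0) u u =
    \sum_i (skew A *m (invmx A.1 *m usubmx u)) i 0 ^+ 2.
  rewrite /Jext tr_block_mx !trmx0 mulmx_block !mulmx0 !mul0mx !addr0 form_block form0 addr0.
  rewrite !mulmxA -[J^T *m A.1]trmxK trmx_mul trmxK -!mulmxA form_tr_mul.
  by rewrite /skew -!mulmxA mulKVmx.
by move: (\sum_i _) (\sum_i _) (_ 0 0) (A.2 ^- 2) => a b c s; field.
Qed.

End HeisenbergMetric.

(** * The lattice and its projection *)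

Section HeisenbergLattice.
Context {R : realType} {n : nat}.
Local Notation v := 'cV[R]_(n + n).
Local Notation h := 'cV[R]_(n + n + 1).
Local Notation rmx := (map_mx (intr : int -> R)).
Implicit Types (x y : h).
Variable r : n.-tuple nat.
Hypothesis hr : Dset r.

Lemma r_gt0 i : 0 < (tnth r i)%:R :> R.
Proof. by case: hr => /all_tnthP/(_ i) ? _; rewrite ltr0n. Qed.

(** The last condition is on the Z-coordinate of the factorization of [x] into the
    exponentials of its X-part, its Y-part and a multiple of Z, in this order. *)
Definition integral_coords : set h :=
  [set x | [/\ forall i, x (iX i) 0 / (tnth r i)%:R \is a Num.int,
    forall i, x (iY i) 0 \is a Num.int
    & x iZ 0 - 2^-1 * \sum_i x (iX i) 0 * x (iY i) 0 \is a Num.int]].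

Lemma hmul_v x y : usubmx (hmul x y) = usubmx x + usubmx y.
Proof.
by rewrite /hmul bracketE scalerA ezE !linearD linearZ /= col_mxKu scaler0 addr0.
Qed.

Lemma hmul_X x y i : hmul x y (iX i) 0 = x (iX i) 0 + y (iX i) 0.
Proof.
have /matrixP/(_ (lshift n i) 0) := hmul_v x y; rewrite !mxE.
by [].
Qed.

Lemma hmul_Y x y i : hmul x y (iY i) 0 = x (iY i) 0 + y (iY i) 0.
Proof.
have /matrixP/(_ (rshift n i) 0) := hmul_v x y; rewrite !mxE.
by [].
Qed.

Lemma hmul_Z x y : hmul x y iZ 0 = x iZ 0 + y iZ 0 +
  2^-1 * \sum_i (x (iX i) 0 * y (iY i) 0 - x (iY i) 0 * y (iX i) 0).
Proof. by rewrite /hmul /bracket !mxE !eqxx mulr1. Qed.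

Lemma integral_X x i : integral_coords x -> x (iX i) 0 \is a Num.int.
Proof.
case=> /(_ i) xi _ _; rewrite -[x _ _](divfK (lt0r_neq0 (r_gt0 i))).
by rewrite rpredM// rpred_nat.
Qed.

Lemma integral_coords_subgroup : is_subgroup integral_coords.
Proof.
split.
- split=> [i|i|]; rewrite ?mxE ?mul0r ?rpred0//.
  by under eq_bigr do rewrite !mxE mul0r; rewrite big1 // mulr0 subr0 rpred0.
- move=> x y Hx Hy; have [xX xY xZ] := Hx; have [yX yY yZ] := Hy; split=> [i|i|].
  + by rewrite hmul_X mulrDl rpredD.
  + by rewrite hmul_Y rpredD.
  + rewrite hmul_Z; under [X in _ - _ * X]eq_bigr do rewrite hmul_X hmul_Y.
    have -> : x iZ 0 + y iZ 0 +
        2^-1 * \sum_i (x (iX i) 0 * y (iY i) 0 - x (iY i) 0 * y (iX i) 0) -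
        2^-1 * \sum_i (x (iX i) 0 + y (iX i) 0) * (x (iY i) 0 + y (iY i) 0) =
      (x iZ 0 - 2^-1 * \sum_i x (iX i) 0 * x (iY i) 0) +
      (y iZ 0 - 2^-1 * \sum_i y (iX i) 0 * y (iY i) 0) -
      \sum_i x (iY i) 0 * y (iX i) 0.
      rewrite [X in _ + 2^-1 * X]sumrB.
      under [X in _ - _ * X = _]eq_bigr do rewrite mulrDl !mulrDr.
      rewrite !big_split /=.
      rewrite [\sum_i y (iX i) 0 * x (iY i) 0](eq_bigr _ (fun i _ => mulrC _ _)).
      by field.
    by apply: rpredB; [exact: rpredD|apply: rpred_sum => i _; apply: rpredM => //; exact: integral_X].
- move=> x Hx; have [xX xY xZ] := Hx; split=> [i|i|].
  + by rewrite mxE mulNr rpredN.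
  + by rewrite mxE rpredN.
  + under eq_bigr do rewrite !mxE mulrNN.
    have -> : (hinv x) iZ 0 - 2^-1 * \sum_i x (iX i) 0 * x (iY i) 0 =
       - (x iZ 0 - 2^-1 * \sum_i x (iX i) 0 * x (iY i) 0) - \sum_i x (iX i) 0 * x (iY i) 0.
      by rewrite mxE; field.
    apply: rpredB; first by rewrite rpredN.
    by apply: rpred_sum => i _; apply: rpredM => //; exact: integral_X.
Qed.

Lemma iXE i j : (iX i == iX j :> 'I_(n + n + 1)) = (i == j).
Proof. by rewrite /iX (inj_eq (@lshift_inj _ _)) (inj_eq (@lshift_inj _ _)). Qed.
Lemma iXYE i j : (iX i == iY j :> 'I_(n + n + 1)) = false.
Proof. by rewrite /iX /iY (inj_eq (@lshift_inj _ _)) eq_lrshift. Qed.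
Lemma iXZE i : (iX i == iZ :> 'I_(n + n + 1)) = false.
Proof. by rewrite /iX /iZ eq_lrshift. Qed.
Lemma iYZE i : (iY i == iZ :> 'I_(n + n + 1)) = false.
Proof. by rewrite /iY /iZ eq_lrshift. Qed.

Lemma integral_coords_gens : Gamma_gens r `<=` integral_coords.
Proof.
move=> x [[i ->]|[[i ->]|->]].
- split=> [j|j|].
  + rewrite !mxE iXE eqxx andbT; case: eqVneq => [->|_].
      by rewrite mulr1 divff ?rpred1// lt0r_neq0// r_gt0.
    by rewrite mulr0 mul0r rpred0.
  + by rewrite !mxE eq_sym iXYE mulr0 rpred0.
  + rewrite big1 => [|j _]; last by rewrite !mxE [iY j == _]eq_sym iXYE !mulr0.
    by rewrite !mxE eq_sym iXZE !mulr0 subr0 rpred0.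
- split=> [j|j|].
  + by rewrite !mxE iXYE mul0r rpred0.
  + by rewrite !mxE eqxx andbT rpred_nat.
  + rewrite big1 => [|j _]; last by rewrite !mxE iXYE mul0r.
    by rewrite !mxE eq_sym iYZE mulr0 subr0 rpred0.
- split=> [j|j|].
  + by rewrite !mxE iXZE mul0r rpred0.
  + by rewrite !mxE iYZE rpred0.
  + rewrite big1 => [|j _]; last by rewrite !mxE iXZE mul0r.
    by rewrite !mxE !eqxx mulr0 subr0 rpred1.
Qed.

Lemma Gamma_integral : Gamma r `<=` integral_coords.
Proof. by apply: smallest_sub; [exact: integral_coords_subgroup|exact: integral_coords_gens]. Qed.

Lemma Gamma_subgroup : @is_subgroup R n (Gamma r).
Proof.
split.
- by move=> H [[]].
- by move=> x y Gx Gy H HP; have [[_ HM _] _] := HP; apply: HM; [exact: Gx|exact: Gy].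
- by move=> x Gx H HP; have [[_ _ HV] _] := HP; apply: HV; exact: Gx.
Qed.

Lemma Gamma_gen x : Gamma_gens r x -> Gamma r x.
Proof. by move=> gx H [_]; apply. Qed.

Lemma basisZE : basisZ = delta_mx iZ 0 :> h. Proof. by []. Qed.

Lemma form_Jext_z x c : form Jext x (c *: basisZ) = 0.
Proof. by rewrite formZr /form -mulmxA Jext_z mulmx0 mxE mulr0. Qed.

Lemma hmul_central x c : hmul x (c *: basisZ) = x + c *: basisZ.
Proof. by rewrite /hmul bracketE form_Jext_z scale0r scaler0 addr0. Qed.

Lemma Gamma_central (c : int) : Gamma r (c%:~R *: basisZ : h).
Proof.
have [G0 GM GV] := Gamma_subgroup.
have Gnat (k : nat) : Gamma r (k%:R *: basisZ : h).
  elim: k => [|k IH]; first by rewrite scale0r.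
  rewrite -natr1 scalerDl -hmul_central; apply: GM => //.
  by rewrite scale1r; apply: Gamma_gen; right; right.
case: c => k; first exact: Gnat.
by rewrite NegzE rmorphN /= scaleNr; exact: (GV _ (Gnat k.+1)).
Qed.

Lemma zlattice0 : zlattice r (0 : v).
Proof. by have [G0 _ _] := Gamma_subgroup; exists 0; rewrite // /proj_v linear0. Qed.

Lemma zlatticeD (a b : v) : zlattice r a -> zlattice r b -> zlattice r (a + b).
Proof.
have [_ GM _] := Gamma_subgroup; move=> [x Gx <-] [y Gy <-].
by exists (hmul x y); [exact: GM|rewrite /proj_v hmul_v].
Qed.

Lemma zlatticeN (a : v) : zlattice r a -> zlattice r (- a).
Proof.
have [_ _ GV] := Gamma_subgroup; move=> [x Gx <-].
by exists (hinv x); [exact: GV|rewrite /proj_v linearN].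
Qed.

Lemma zlatticeZ (c : int) (a : v) : zlattice r a -> zlattice r (c%:~R *: a).
Proof.
move=> za; have znat (k : nat) : zlattice r (k%:R *: a).
  elim: k => [|k IH]; first by rewrite scale0r; exact: zlattice0.
  by rewrite -natr1 scalerDl scale1r; exact: zlatticeD.
case: c => k; first exact: znat.
by rewrite NegzE rmorphN /= scaleNr; exact: (zlatticeN (znat k.+1)).
Qed.

Lemma zlattice_sum (I : finType) (f : I -> v) : (forall i, zlattice r (f i)) ->
  zlattice r (\sum_i f i).
Proof. by move=> zf; apply: big_ind => [||i _]; [exact: zlattice0|exact: zlatticeD|exact: zf]. Qed.

Lemma diag_rE (u : v) : diag_r r *m u =
  \sum_i u (lshift n i) 0 *: ((tnth r i)%:R *: delta_mx (lshift n i) 0)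
  + \sum_i u (rshift n i) 0 *: delta_mx (rshift n i) 0.
Proof.
apply/colP => j; rewrite mul_diag_mx !mxE !summxE.
case: (split_ordP j) => k ->; rewrite ?row_mxEl ?row_mxEr.
  rewrite (bigD1 k)//= big1 => [|i ik]; last first.
    by rewrite !mxE (inj_eq (@lshift_inj _ _)) eq_sym (negPf ik) !mulr0.
  rewrite big1 => [|i _]; last by rewrite !mxE eq_lrshift mulr0.
  by rewrite !mxE !eqxx mulr1 !addr0 mulrC.
rewrite big1 => [|i _]; last by rewrite !mxE eq_sym eq_lrshift !mulr0.
rewrite (bigD1 k)//= big1 => [|i ik]; last first.
  by rewrite !mxE (inj_eq (@rshift_inj _ _)) eq_sym (negPf ik) !mulr0.
by rewrite !mxE !eqxx mul1r mulr1 add0r addr0.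
Qed.

Lemma zlattice_diag (a : 'cV[int]_(n + n)) : zlattice r (diag_r r *m rmx a).
Proof.
rewrite diag_rE; apply: zlatticeD; apply: zlattice_sum => i; rewrite mxE; apply: zlatticeZ.
  exists ((tnth r i)%:R *: basisX i); first by apply: Gamma_gen; left; exists i.
  apply/colP => j; rewrite !mxE; congr (_ * (_ && _)%:R).
exists (basisY i); first by apply: Gamma_gen; right; left; exists i.
by apply/colP => j; rewrite !mxE.
Qed.

Lemma integral_coords_v x : integral_coords x -> exists a : 'cV[int]_(n + n),
  usubmx x = diag_r r *m rmx a.
Proof.
case=> xX xY _.
have /choice[f fP] (i : 'I_n) : exists m : int, x (iX i) 0 / (tnth r i)%:R = m%:~R.
  exact/intrP.
have /choice[g gP] (i : 'I_n) : exists m : int, x (iY i) 0 = m%:~R by exact/intrP.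
exists (col_mx (\col_i f i) (\col_i g i)).
apply/colP => j; rewrite mul_diag_mx !mxE.
case: (split_ordP j) => k ->; rewrite ?row_mxEl ?row_mxEr ?col_mxEu ?col_mxEd !mxE.
  by rewrite -fP mulrC divfK// lt0r_neq0// r_gt0.
by rewrite -gP mul1r.
Qed.

Lemma zlatticeP (u : v) : zlattice r u <-> exists a : 'cV[int]_(n + n), u = diag_r r *m rmx a.
Proof.
split=> [[x Gx <-]|[a ->]]; last exact: zlattice_diag.
exact/integral_coords_v/Gamma_integral.
Qed.

Lemma eq_integral_Z x y : integral_coords x -> integral_coords y -> usubmx x = usubmx y ->
  exists c : int, x = y + c%:~R *: basisZ.
Proof.
move=> [_ _ xZ] [_ _ yZ] xy.
have eX i : x (iX i) 0 = y (iX i) 0 by move/matrixP/(_ (lshift n i) 0): xy; rewrite !mxE.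
have eY i : x (iY i) 0 = y (iY i) 0 by move/matrixP/(_ (rshift n i) 0): xy; rewrite !mxE.
have /intrP[c cE] : x iZ 0 - y iZ 0 \is a Num.int.
  have := rpredB xZ yZ; under eq_bigr do rewrite eX eY.
  by rewrite opprB addrA addrNK.
exists c; rewrite basisZE ezE -[x]vsubmxK -[y]vsubmxK xy.
rewrite scale_col_mx scaler0 add_col_mx addr0; congr col_mx.
apply/colP => j; rewrite !mxE !ord1 eqxx mulr1 -cE addrC; exact: esym (subrK (y iZ 0) (x iZ 0)).
Qed.

(** An element with integral coordinates has the same projection as some element of
    the lattice, and the two differ by an integral multiple of Z. *)
Lemma GammaP x : Gamma r x <-> integral_coords x.
Proof.
split=> [|Hx]; first exact: Gamma_integral.
have [a xa] := integral_coords_v Hx.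
have [y Gy yx] := zlattice_diag a.
have [c ->] := eq_integral_Z Hx (Gamma_integral Gy) (etrans xa (esym yx)).
rewrite -hmul_central; have [_ GM _] := Gamma_subgroup; apply: GM => //.
exact: Gamma_central.
Qed.

End HeisenbergLattice.

(** * Borel functions of several variables and iterated integrals *)

Section BorelVectors.
Context {R : realType}.

Definition opens N : set (set 'cV[R]_N) := [set U | open U].
Local Notation BV N := (g_sigma_algebraType (@opens N)).

(** Every open set is a countable union of boxes with rational corners. *)
Lemma measurable_vector d (T : measurableType d) N (phi : T -> BV N) :
  (forall i, measurable_fun setT (fun t => phi t i 0)) -> measurable_fun setT phi.
Proof.
move=> mphi; apply: (@measurability _ _ T (BV N) setT phi (@opens N) erefl).
move=> _ [U oU <-]; rewrite setTI.
pose box (ab : 'cV[rat]_N * 'cV[rat]_N) : set 'cV[R]_N :=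
  [set x | forall i, ratr (ab.1 i 0) < x i 0 < ratr (ab.2 i 0)].
have UE : U = \bigcup_ab (if `[< box ab `<=` U >] then box ab else set0).
  apply/seteqP; split => [x Ux|x [ab _]]; last first.
    by case: asboolP => // abU; apply: abU.
  have /nbhs_ballP[e /= e0 xe] : nbhs x U by exact: open_nbhs_nbhs.
  have /choice[a aP] (i : 'I_N) : exists q : rat, x i 0 - e < ratr q < x i 0.
    have : x i 0 - e < x i 0 by lra.
    by move=> /rat_in_itvoo[q]; rewrite in_itv /= => h; exists q.
  have /choice[b bP] (i : 'I_N) : exists q : rat, x i 0 < ratr q < x i 0 + e.
    have : x i 0 < x i 0 + e by lra.
    by move=> /rat_in_itvoo[q]; rewrite in_itv /= => h; exists q.
  exists (\col_i a i, \col_i b i) => //.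
  rewrite asboolT.
    by move=> i /=; rewrite !mxE; have /andP[_ ->] := aP i; have /andP[-> _] := bP i.
  move=> y /= yab; apply: xe; split => // i j; rewrite ord1 /ball /= ltr_norml.
  move: (yab i); rewrite !mxE => /andP[]; have /andP[? ?] := aP i; have /andP[? ?] := bP i.
  by move=> ? ?; apply/andP; split; lra.
rewrite UE preimage_bigcup; apply: countable_bigcupT_measurable; first exact: countableP.
move=> ab; case: asboolP => _; last by rewrite preimage_set0.
have -> : phi @^-1` box ab = \bigcap_(i in [set: 'I_N]) ((fun t => phi t i 0) @^-1` `]ratr (ab.1 i 0), ratr (ab.2 i 0)[).
  apply/seteqP; split => t /= tH; first by move=> i _ /=; rewrite in_itv; exact: tH.
  by move=> i; have := tH i I; rewrite /= in_itv.
apply: fin_bigcap_measurable => // i _; rewrite -[X in measurable X]setTI.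
exact: mphi.
Qed.

Lemma measurable_coord N i : measurable_fun setT (fun x : BV N => x i 0 : R).
Proof.
apply: (measurability _ (measurable_realfun.RGenOpens.measurableE R)) => _ [_ [a [b ->] <-]].
rewrite setTI; apply: sub_sigma_algebra.
apply: open_comp; last exact: interval_open.
by move=> x _; exact: coord_continuous.
Qed.

Lemma measurable_cons N d (T : measurableType d) (f : T -> R) (phi : T -> BV N) :
  measurable_fun setT f -> measurable_fun setT phi ->
  measurable_fun setT (fun t => col_mx (f t)%:M (phi t) : BV N.+1).
Proof.
move=> mf mphi; apply: measurable_vector => i; case: (split_ordP (i : 'I_(1 + N))) => j ->.
  apply: eq_measurable_fun mf => t _.
  by rewrite (col_mxEu (f t)%:M (phi t : 'cV_N)) !ord1 mxE mulr1n.
have -> : (fun t => (col_mx (f t)%:M (phi t) : 'cV[R]_(1 + N)) (rshift 1 j) 0) =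
    (fun x : BV N => x j 0) \o phi.
  by apply/funext => t /=; rewrite (col_mxEd (f t)%:M (phi t : 'cV_N)).
by apply: measurableT_comp mphi; exact: measurable_coord.
Qed.

(** Products of exhaustions exhaust the product; so the product measure is again
    sigma-finite and the construction can be repeated, one variable at a time. *)
Lemma tonelli_product d1 d2 (T1 : measurableType d1) (T2 : measurableType d2)
    (m1 : {sigma_finite_measure set T1 -> \bar R}) (m2 : {sigma_finite_measure set T2 -> \bar R}) :
  exists m : {sigma_finite_measure set (T1 * T2)%type -> \bar R},
    forall f : T1 * T2 -> \bar R, measurable_fun setT f -> (forall x, (0 <= f x)%E) ->
      (\int[m]_z f z = \int[m1]_x \int[m2]_y f (x, y))%E.
Proof.
have sfin : sigma_finite setT (product_measure1 m1 m2).
  have /sigma_finiteP[F [TF ndF Foo]] := sigma_finiteT m1.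
  have /sigma_finiteP[G [TG ndG Goo]] := sigma_finiteT m2.
  exists (fun k => F k `*` G k) => [|k]; last first.
    have [mF Fk] := Foo k; have [mG Gk] := Goo k; split; first exact: measurableX.
    by rewrite product_measure1E// lte_mul_pinfty// ge0_fin_numE.
  apply/seteqP; split => // -[x y] _.
  have [i _ Fix] : (\bigcup_i F i) x by rewrite -TF.
  have [j _ Gjy] : (\bigcup_i G i) y by rewrite -TG.
  exists (maxn i j) => //; split => /=.
    by move: x Fix; exact/subsetPset/ndF/leq_maxl.
  by move: y Gjy; exact/subsetPset/ndG/leq_maxr.
pose m : {sigma_finite_measure set (T1 * T2)%type -> \bar R} :=
  HB.pack (product_measure1 m1 m2) (Measure_isSigmaFinite.Build _ _ _ (product_measure1 m1 m2) sfin).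
by exists m => f mf f0; exact: fubini_tonelli1.
Qed.

(** Writing the iterated integral as one integral gives access to monotonicity,
    to series and to the measurability of integrals that depend on a parameter. *)
Lemma integralN_representation N : exists d (T : measurableType d)
    (mu : {sigma_finite_measure set T -> \bar R}) (phi : T -> BV N),
  measurable_fun setT phi /\ forall f : BV N -> \bar R, (forall x, (0 <= f x)%E) ->
    measurable_fun setT f -> integralN f = (\int[mu]_t f (phi t))%E.
Proof.
elim: N => [|N [d [T [mu [phi [mphi IH]]]]]].
  exists _, unit, \d_tt, (fun=> 0); split; first exact: measurable_cst.
  move=> f f0 mf; rewrite integral_dirac ?diracT ?mul1e//.
pose phi' := fun tw : measurableTypeR R * T => col_mx (tw.1)%:M (phi tw.2) : BV N.+1.
have mphi' : measurable_fun setT phi'.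
  by apply: measurable_cons; [exact: measurable_fst|apply: measurableT_comp mphi _].
have [prod prodE] := tonelli_product (@lebesgue_measure R) mu.
exists _, (measurableTypeR R * T)%type, prod, phi'; split => // f f0 mf.
rewrite prodE//; last exact: measurableT_comp mf _.
apply: eq_integral => t _; apply: (IH (fun y : BV N => f (col_mx t%:M y : BV N.+1))) => //.
apply: (measurableT_comp mf); apply: measurable_cons; first exact: measurable_cst.
exact: measurable_id.
Qed.

End BorelVectors.

Section IteratedIntegral.
Context {R : realType}.
Local Notation BV N := (g_sigma_algebraType (@opens R N)).
Local Notation leb := (@lebesgue_measure R).

Lemma lebesgue_translation (F : R -> \bar R) (c : R) : measurable_fun setT F ->
  (forall t, (0 <= F t)%E) -> (\int[leb]_t F (t + c)%R = \int[leb]_t F t)%E.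
Proof.
move=> mF F0.
pose sh : measurableTypeR R -> measurableTypeR R := fun t : R => t + c.
have mT : measurable_fun setT sh.
  by apply: measurable_funD; [exact: measurable_id|exact: measurable_cst].
transitivity (\int[pushforward leb sh]_t F t)%E; first by rewrite ge0_integral_pushforward.
apply: eq_measure_integral => A mA _; apply/esym/lebesgue_measure_unique => //= _ [[a b]] _ <-.
rewrite /pushforward.
have -> : sh @^-1` `]a, b]%classic = `]a - c, b - c]%classic.
  by apply/seteqP; split => t /=; rewrite !in_itv /= ltrBlDr lerBrDr.
rewrite !lebesgue_measure_itv /= !lte_fin ltrD2r; case: ifP => // _.
by rewrite -!EFinB opprB addrA subrK.
Qed.

Lemma integralN_ge0 N (f : 'cV[R]_N -> \bar R) : (forall x, (0 <= f x)%E) ->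
  (0 <= integralN f)%E.
Proof.
by elim: N f => [|N IH] f f0 //=; apply: integral_ge0 => t _; exact: IH.
Qed.

Section Basic.
Variable N : nat.
Implicit Types f g : BV N -> \bar R.

Lemma integralN_le f g : measurable_fun setT f -> measurable_fun setT g ->
  (forall x, (0 <= f x)%E) -> (forall x, (f x <= g x)%E) -> (integralN f <= integralN g)%E.
Proof.
move=> mf mg f0 fg; have [d [T [mu [phi [mphi IE]]]]] := @integralN_representation R N.
rewrite !IE// => [|x]; last exact: le_trans (fg x).
apply: ge0_le_integral => //.
- exact: measurableT_comp.
- exact: measurableT_comp.
Qed.

Lemma integralN_series (f : nat -> BV N -> \bar R) : (forall k, measurable_fun setT (f k)) ->
  (forall k x, (0 <= f k x)%E) ->
  integralN (fun x => \sum_(k <oo) f k x)%E = (\sum_(k <oo) integralN (f k))%E.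
Proof.
move=> mf f0; have [d [T [mu [phi [mphi IE]]]]] := @integralN_representation R N.
rewrite IE => [|x|]; last first.
- exact: ge0_emeasurable_sum.
- by apply: nneseries_ge0.
rewrite integral_nneseries//; last by move=> k; exact: measurableT_comp.
by apply: eq_eseriesr => k _; rewrite IE.
Qed.

Lemma integralN_scale f c : measurable_fun setT f -> (forall x, (0 <= f x)%E) -> 0 <= c ->
  integralN (fun x => c%:E * f x)%E = (c%:E * integralN f)%E.
Proof.
move=> mf f0 c0; have [d [T [mu [phi [mphi IE]]]]] := @integralN_representation R N.
rewrite !IE// => [|x|]; last first.
- exact: measurable_funeM.
- by rewrite mule_ge0.
by rewrite ge0_integralZl//; exact: measurableT_comp.
Qed.

End Basic.

Lemma measurable_slice N (f : BV N.+1 -> \bar R) : measurable_fun setT f ->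
  (forall x, (0 <= f x)%E) ->
  measurable_fun setT (fun t : measurableTypeR R => integralN (fun y : 'cV[R]_N => f (col_mx t%:M y))).
Proof.
move=> mf f0; have [d [T [mu [phi [mphi IE]]]]] := @integralN_representation R N.
pose F := fun tw : measurableTypeR R * T => f (col_mx (tw.1)%:M (phi tw.2) : BV N.+1).
have mF : measurable_fun setT F.
  apply: (measurableT_comp mf); apply: measurable_cons; [exact: measurable_fst|].
  exact: measurableT_comp mphi _.
apply: eq_measurable_fun (@measurable_fun_fubini_tonelli_F _ _ (measurableTypeR R) T R mu F mF (fun tw => f0 _)) => t _.
rewrite /fubini_F IE//.
by apply: (measurableT_comp mf); apply: measurable_cons; [exact: measurable_cst|exact: measurable_id].
Qed.

(** When the variables are integrated in order, the translation of each depends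
    only on those that are already fixed, so the invariance of the Lebesgue
    measure of the line is enough. *)
Lemma integralN_shear N (f : BV N -> \bar R) (s : 'cV[R]_N -> 'cV[R]_N) :
  measurable_fun setT f -> (forall x, (0 <= f x)%E) ->
  (forall (i : 'I_N) (x y : 'cV[R]_N), (forall j : 'I_N, (j < i)%N -> x j 0 = y j 0) -> s x i 0 = s y i 0) ->
  integralN (fun x => f (x + s x)) = integralN f.
Proof.
elim: N f s => [|N IH] f s mf f0 sT.
  by rewrite /=; congr f; apply/matrixP => -[].
have mslice (c : R) : measurable_fun setT (fun y : BV N => f (col_mx c%:M y : BV N.+1)).
  apply: (measurableT_comp mf); apply: measurable_cons; first exact: measurable_cst.
  exact: measurable_id.
have s00 (x : 'cV[R]_(1 + N)) : usubmx (s x : 'cV[R]_(1 + N)) = (s 0 (@lshift 1 N 0) 0)%:M.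
  apply/colP => i; rewrite !mxE !ord1 mulr1n; exact: sT.
rewrite /=.
transitivity (\int[leb]_t integralN (fun y : 'cV[R]_N =>
   f (col_mx (t + s 0%R (@lshift 1 N 0) 0)%:M%R y)))%E; last first.
  by apply: (lebesgue_translation _ (measurable_slice mf f0)) => t; exact: integralN_ge0.
apply: eq_integral => t _.
pose st (y : 'cV[R]_N) : 'cV[R]_N := dsubmx (s (col_mx t%:M y) : 'cV[R]_(1 + N)).
pose g (y : BV N) := f (col_mx (t + s 0 (@lshift 1 N 0) 0)%:M y : BV N.+1).
rewrite -[RHS]/(integralN g) -(IH g st); last 3 first.
- exact: mslice.
- by move=> y; exact: f0.
- move=> i x y xy; rewrite !mxE; apply: sT => j.
  case: (split_ordP (j : 'I_(1 + N))) => k -> ki.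
    exact: etrans (col_mxEu _ x k 0) (esym (col_mxEu _ y k 0)).
  apply: etrans (col_mxEd t%:M x k 0) (etrans _ (esym (col_mxEd t%:M y k 0))).
  exact: xy.
congr (integralN _); apply/funext => y; congr f.
have -> : (t + s 0 (@lshift 1 N 0) 0)%:M = t%:M + usubmx (s (col_mx t%:M y) : 'cV[R]_(1 + N)) :> 'cV[R]_1.
  by rewrite s00 raddfD.
have split_sum (S : 'cV[R]_(1 + N)) :
    col_mx t%:M y + S = col_mx (t%:M + usubmx S) (y + dsubmx S).
  by rewrite -add_col_mx vsubmxK.
exact: split_sum.
Qed.

Lemma measurable_cube N (A : set R) : measurable A ->
  measurable_fun setT (fun x : BV N => (\prod_i \1_A (x i 0))%:E : \bar R).
Proof.
move=> mA; apply/measurable_EFinP; apply: measurable_prod => i _.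
apply: (@measurableT_comp _ _ _ _ _ _ (\1_A : R -> R)).
  exact: measurable_indic.
exact: measurable_coord.
Qed.

Lemma integralN_cube N (A : set R) a : measurable A -> leb A = a%:E ->
  integralN (fun x : 'cV[R]_N => (\prod_i \1_A (x i 0))%:E) = (a ^+ N)%:E.
Proof.
move=> mA Aa; elim: N => [|N IH]; first by rewrite /= big_ord0 expr0.
rewrite /=.
transitivity (\int[leb]_t ((a ^+ N)%:E * (\1_A t)%:E))%E.
  apply: eq_integral => t _; rewrite muleC -IH -integralN_scale.
  - congr (integralN _); apply/funext => y; rewrite -EFinM; congr (_%:E).
    rewrite big_ord_recl; congr (_ * _).
      have -> : ord0 = @lshift 1 N 0 by apply/val_inj.
      by congr (\1_A _); apply: etrans (col_mxEu t%:M y 0 0) _; rewrite mxE mulr1n.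
    apply: eq_bigr => i _; have -> : lift ord0 i = @rshift 1 N i by apply/val_inj.
    by congr (\1_A _); exact: (col_mxEd t%:M y i 0).
  - exact: measurable_cube.
  - by move=> x; rewrite lee_fin prodr_ge0.
  - by [].
rewrite ge0_integralZl//.
- by rewrite integral_indic// setIT exprSr EFinM; congr (_ * _)%E; exact: Aa.
- exact/measurable_EFinP/measurable_indic.
- by rewrite lee_fin exprn_ge0// -lee_fin -Aa measure_ge0.
Qed.
End IteratedIntegral.

(** * Volume of the quotient *)

Section GroupLaw.
Context {R : realType} {n : nat}.
Local Notation h := 'cV[R]_(n + n + 1).
Implicit Types x y z : h.

Lemma form_z_Jext x c : form Jext (c *: basisZ : h) x = 0.
Proof. by rewrite form_skew ?tr_Jext// form_Jext_z oppr0. Qed.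

Lemma hmulE x y : hmul x y = x + y + (2^-1 * form Jext x y) *: basisZ.
Proof. by rewrite /hmul bracketE scalerA. Qed.

Lemma hmulA x y z : hmul (hmul x y) z = hmul x (hmul y z).
Proof.
rewrite !hmulE !formDl !formDr form_Jext_z form_z_Jext.
apply/matrixP => i j; rewrite !mxE; ring.
Qed.

Lemma hmul_hinv x : hmul x (hinv x) = 0.
Proof.
rewrite hmulE /hinv -scaleN1r formZr form_skew0 ?tr_Jext// !mulr0 scale0r addr0.
by rewrite scaleN1r subrr.
Qed.

Lemma hinvK x : hinv (hinv x) = x.
Proof. exact: opprK. Qed.

Lemma hinv_hmul x : hmul (hinv x) x = 0.
Proof. by rewrite -{2}[x]hinvK hmul_hinv. Qed.

Lemma hmul0x x : hmul 0 x = x.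
Proof. by rewrite hmulE -(scale0r (0 : h)) formZl mul0r mulr0 !scale0r add0r addr0. Qed.

Lemma hmulx0 x : hmul x 0 = x.
Proof. by rewrite hmulE -(scale0r (0 : h)) formZr mul0r mulr0 !scale0r !addr0. Qed.

Lemma hmulK x y : hmul (hinv x) (hmul x y) = y.
Proof. by rewrite -hmulA hinv_hmul hmul0x. Qed.

Lemma hmulIr x : injective (hmul^~ x).
Proof. by move=> y z /(congr1 (hmul^~ (hinv x))); rewrite /= !hmulA hmul_hinv !hmulx0. Qed.

End GroupLaw.

Section QuotientVolume.
Context {R : realType} {n : nat}.
Local Notation N := (n + n + 1)%N.
Local Notation h := 'cV[R]_(n + n + 1).
Local Notation BV := (g_sigma_algebraType (@opens R (n + n + 1))).
Local Notation rmx := (map_mx (intr : int -> R)).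
Local Notation leb := (@lebesgue_measure R).
Variable r : n.-tuple nat.
Hypothesis hr : Dset r.
Implicit Types (A : 'M[R]_(n + n) * R) (E : set h).

Lemma volumeE A E : GLR A ->
  volume (metric A) E = integralN (fun x => (`|\det A.1 * A.2|^-1)%:E * (\1_E x)%:E)%E.
Proof.
move=> GA; rewrite /volume; congr (integralN _); apply/funext => x.
by rewrite det_metric// -EFinM -exprVn sqrtr_sqr normfV.
Qed.

Lemma measurable_hmul (g : h) : measurable_fun setT (fun x : BV => hmul g x : BV).
Proof.
apply: measurable_vector => i.
have -> : (fun x : BV => (hmul g x : h) i 0) = fun x : BV =>
    (g i 0 + (x : h) i 0 + 2^-1 * (\sum_j (g^T *m Jext) 0 j * (x : h) j 0) * (basisZ : h) i 0).
  by apply/funext => x; rewrite hmulE [LHS]mxE [X in X + _]mxE [X in _ + X]mxE /Defs.form [X in _ * X * _]mxE.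
apply: measurable_funD; first by apply: measurable_funD; [exact: measurable_cst|exact: measurable_coord].
apply: measurable_funM; last exact: measurable_cst.
apply: measurable_funM; first exact: measurable_cst.
apply: measurable_sum => j; apply: measurable_funM; first exact: measurable_cst.
exact: measurable_coord.
Qed.

(** A left translation moves the coordinates in v by constants, and the Z-coordinate
    by a function of the others. *)
Lemma integralN_hmul (g : h) (f : BV -> \bar R) : measurable_fun setT f ->
  (forall x, (0 <= f x)%E) -> integralN (fun x => f (hmul g x)) = integralN f.
Proof.
move=> mf f0.
have -> : (fun x => f (hmul g x)) = fun x => f (x + (g + (2^-1 * form Jext g x) *: basisZ)).
  by apply/funext => x; rewrite hmulE addrAC addrC.
apply: (integralN_shear (s := fun x => g + (2^-1 * form Jext g x) *: basisZ)) => // i x y xy.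
rewrite !mxE !form_Jext; congr (_ + _); case: (split_ordP i) => k iE.
  by rewrite iE -[lshift 1 k == _]/(lshift 1 k == rshift (n + n) ord0) eq_lrshift !mulr0.
suff -> : usubmx x = usubmx y by [].
apply/colP => j; rewrite !mxE; apply: xy.
by rewrite iE /= ltn_addr.
Qed.

Definition cube (L : R) : h -> R := fun x => \prod_i \1_`[0, L[%classic (x i 0).

(** The coordinates in v are reduced first: they determine the shift of the
    Z-coordinate, which is reduced last. *)
Lemma period_translate (L : R) (x : h) : 0 < L ->
  exists k : 'cV[int]_(n + n + 1), cube L (hmul (L *: rmx k) x) = 1.
Proof.
move=> L0.
have fl (t : R) : exists k : int, 0 <= L * k%:~R + t < L.
  exists (- Num.floor (t / L)); rewrite rmorphN /=.
  have := floor_le (t / L); have := floorD1_gt (t / L).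
  rewrite rmorphD /= ler_pdivlMr// ltr_pdivrMr// => ? ?; apply/andP; split; nra.
have /choice[f fP] (j : 'I_(n + n)) := fl (x (lshift 1 j) 0).
pose kv : 'cV[int]_(n + n) := \col_j f j.
have [c cP] := fl (x iZ 0 + 2^-1 * form Jext (L *: rmx (col_mx kv 0)) x).
exists (col_mx kv c%:M); rewrite /cube big1// => i _.
rewrite indicE mem_set//= in_itv /= hmulE.
have -> : form Jext (L *: rmx (col_mx kv c%:M)) x = form Jext (L *: rmx (col_mx kv 0)) x.
  by rewrite !form_Jext !map_col_mx !scale_col_mx !col_mxKu.
case: (split_ordP i) => k ->.
  have -> : (L *: rmx (col_mx kv c%:M) + x + (2^-1 * form Jext (L *: rmx (col_mx kv 0)) x) *: basisZ)
     (lshift 1 k) 0 = L * (f k)%:~R + x (lshift 1 k) 0.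
    rewrite [LHS]mxE [X in X + _]mxE [X in X + _ + _]mxE map_col_mx col_mxEu !mxE.
    by rewrite -[lshift 1 k == _]/(lshift 1 k == rshift (n + n) ord0) eq_lrshift mulr0 addr0.
  exact: fP.
have -> : (L *: rmx (col_mx kv c%:M) + x + (2^-1 * form Jext (L *: rmx (col_mx kv 0)) x) *: basisZ)
     (rshift (n + n) k) 0 = L * c%:~R + (x iZ 0 + 2^-1 * form Jext (L *: rmx (col_mx kv 0)) x).
  rewrite [LHS]mxE [X in X + _]mxE [X in X + _ + _]mxE map_col_mx col_mxEd.
  rewrite [(_ *: basisZ : h) _ _]mxE [X in _ + _ * X]mxE !ord1 !eqxx mulr1 -addrA.
  by rewrite !mxE !eqxx.
exact: cP.
Qed.

(** The factor 2 compensates the 1/2 in the group law. *)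
Lemma Gamma_period (k : 'cV[int]_(n + n + 1)) :
  Gamma r ((2 * \prod_i (tnth r i)%:R) *: rmx k : h).
Proof.
apply/(GammaP hr); set p : R := \prod_i (tnth r i)%:R.
have p_int : p \is a Num.int by apply: rpred_prod => i _; exact: rpred_nat.
have k_int i : rmx k i 0 \is a Num.int by rewrite mxE intr_int.
split=> [i|i|].
- have q_int : \prod_(j | j != i) (tnth r j)%:R \is a @Num.int R.
    by apply: rpred_prod => j _; exact: rpred_nat.
  rewrite mxE /p (bigD1 i)//=.
  have -> : forall q t : R, 2 * ((tnth r i)%:R * q) * t / (tnth r i)%:R = 2 * q * t.
    by move=> q t; field; exact/lt0r_neq0/r_gt0.
  by apply: rpredM => //; apply: rpredM => //; exact: rpred_nat.
- by rewrite mxE; apply: rpredM => //; apply: rpredM => //; exact: rpred_nat.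
- apply: rpredB.
    by rewrite mxE; apply: rpredM => //; apply: rpredM => //; exact: rpred_nat.
  have -> : 2^-1 * \sum_i ((2 * p) *: rmx k) (iX i) 0 * ((2 * p) *: rmx k) (iY i) 0 =
      \sum_i (2 * p * rmx k (iX i) 0) * (p * rmx k (iY i) 0).
    by rewrite mulr_sumr; apply: eq_bigr => i _; rewrite !mxE; field.
  apply: rpred_sum => i _; apply: rpredM; last by apply: rpredM.
  by apply: rpredM => //; apply: rpredM => //; exact: rpred_nat.
Qed.

Lemma prod_r_gt0 : 0 < 2 * \prod_i (tnth r i)%:R :> R.
Proof. by rewrite mulr_gt0// prodr_gt0// => i _; exact: r_gt0. Qed.

Lemma sum_single_le (m0 : nat) (f : nat -> \bar R) (c : \bar R) M : (0 <= c)%E ->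
  (forall m, m != m0 -> f m = 0%E) -> (f m0 <= c)%E -> (\sum_(0 <= m < M) f m <= c)%E.
Proof.
move=> c0 f0 fc; have [mM|Mm] := ltnP m0 M.
  rewrite big_mkord (bigD1 (Ordinal mM))//= big1 ?adde0// => i im.
  by apply: f0; apply: contra im => /eqP im; apply/eqP/val_inj.
rewrite big_mkord big1// => i _; apply: f0.
by rewrite neq_ltn (leq_trans (ltn_ord i) Mm).
Qed.

(** Unfolding. The translations by the vectors of [L Z^N] bring every point into the
    cube of side [L], so [E] is covered by the pieces that each of them moves into
    the cube, and these moves preserve the volume. The moved pieces do not overlap,
    because two points of [E] in the same orbit are equal; their total volume is at
    most that of the cube. Only the inclusion of [L Z^N] in the lattice matters: it
    need not be a subgroup. *)
Lemma borel_injective_volume E : borel E ->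
  (forall x y, E x -> E y -> Gamma_orbit r x y -> x = y) ->
  (integralN (fun x => (\1_E x)%:E) <= ((2 * \prod_i (tnth r i)%:R) ^+ (n + n + 1))%:E)%E.
Proof.
move=> bE inj; set L : R := 2 * \prod_i (tnth r i)%:R.
have L0 : 0 < L := prod_r_gt0.
pose gam (k : 'cV[int]_(n + n + 1)) : h := L *: rmx k.
have gamI : injective gam.
  move=> k l kl; apply/matrixP => i j; move/matrixP/(_ i j): kl; rewrite !mxE.
  by move/(mulfI (lt0r_neq0 L0))/intr_inj.
have mE : measurable_fun setT (fun x : BV => (\1_E x)%:E : \bar R).
  by apply/measurable_EFinP/measurable_indic.
have mF : measurable_fun setT (fun x : BV => (cube L x)%:E : \bar R).
  by apply: measurable_cube.
have cube0 x : 0 <= cube L x by apply: prodr_ge0.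
pose piece (o : option 'cV[int]_(n + n + 1)) (y : BV) : \bar R :=
  if o is Some k then ((\1_E (hmul (hinv (gam k)) y))%:E * (cube L y)%:E)%E else 0%E.
have piece0 o y : (0 <= piece o y)%E.
  by case: o => [k|]//=; rewrite mule_ge0// lee_fin.
have mpiece o : measurable_fun setT (piece o).
  case: o => [k|] /=; last exact: measurable_cst.
  apply: emeasurable_funM => //; apply: (measurableT_comp mE).
  exact: measurable_hmul.
pose shifted (m : nat) (x : BV) : \bar R :=
  if pickle_inv m is Some k then piece (Some k) (hmul (gam k) x) else 0%E.
have mshifted m : measurable_fun setT (shifted m).
  rewrite /shifted; case: (pickle_inv m) => [k|]; last exact: measurable_cst.
  by apply: (measurableT_comp (mpiece (Some k))); exact: measurable_hmul.
have shifted0 m x : (0 <= shifted m x)%E.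
  by rewrite /shifted; case: (pickle_inv m) => [k|].
apply: (@le_trans _ _ (integralN (fun x => \sum_(m <oo) shifted m x)%E)).
  apply: integralN_le => //; first exact: ge0_emeasurable_sum.
  move=> x; have [k kx] := period_translate x L0.
  apply: le_trans (nneseries_lim_ge (pickle k).+1 (fun m _ _ => shifted0 m x)).
  rewrite big_nat_recr //= -[leLHS]add0e leeD ?sume_ge0//.
  by rewrite /shifted pickleK_inv /piece hmulK /gam kx mule1.
rewrite integralN_series//.
have -> : (\sum_(m <oo) integralN (shifted m) = \sum_(m <oo) integralN (piece (pickle_inv m)))%E.
  apply: eq_eseriesr => m _; rewrite /shifted; case: (pickle_inv m) => [k|]//.
  exact: (integralN_hmul (gam k) (mpiece (Some k)) (piece0 (Some k))).
rewrite -integralN_series//.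
have <- : integralN (fun x : h => (cube L x)%:E) = (L ^+ (n + n + 1))%:E.
  apply: integralN_cube; first exact: measurable_itv.
  by rewrite lebesgue_measure_itv /= lte_fin L0 sube0.
apply: integralN_le => //.
- by apply: ge0_emeasurable_sum.
- by move=> x; apply: nneseries_ge0.
move=> y; apply: lime_le; first by apply: is_cvg_nneseries.
apply: nearW => M.
have [[k Ek]|nE] := pselect (exists k, E (hmul (hinv (gam k)) y)); last first.
  rewrite big1 ?lee_fin// => m _; rewrite /piece; case: (pickle_inv m) => [k|]//.
  by rewrite indicE memNset ?mul0e// => Ek; apply: nE; exists k.
apply: (@sum_single_le (pickle k)) => [|m mk|]; first by rewrite lee_fin.
  rewrite /piece; have := @pickle_invK 'cV[int]_(n + n + 1) m.
  case: (pickle_inv m) => [l|]//= lm.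
  rewrite indicE memNset ?mul0e// => El; case/eqP: mk; rewrite -lm; congr pickle.
  apply: gamI; apply: (can_inj (@hinvK R n)); apply: (@hmulIr _ _ y).
  apply: inj => //; exists (hmul (hinv (gam k)) (gam l)).
    by have [_ GM GV] := @Gamma_subgroup R n r; apply: GM; [apply: GV|]; exact: Gamma_period.
  by rewrite hmulA -(hmulA (gam l)) hmul_hinv hmul0x.
by rewrite pickleK_inv /piece indicE mem_set// mul1e.
Qed.

Lemma quotient_meas_le A : GLR A ->
  (quotient_meas (metric A) (Gamma_orbit r) <=
   (`|\det A.1 * A.2|^-1 * (2 * \prod_i (tnth r i)%:R) ^+ (n + n + 1))%:E)%E.
Proof.
move=> GA; apply: ge_ereal_sup => _ [E [bE inj] <-]; rewrite volumeE//.
have mE : measurable_fun setT (fun x : BV => (\1_E x)%:E : \bar R).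
  by apply/measurable_EFinP/measurable_indic.
by rewrite integralN_scale// EFinM lee_wpmul2l// borel_injective_volume.
Qed.

(** The open unit cube meets every orbit at most once: the coordinates of an element
    of the lattice that maps one of its points to another are integers of absolute
    value less than 1, in v first and then along Z. *)
Lemma quotient_meas_ge A : GLR A ->
  ((`|\det A.1 * A.2|^-1)%:E <= quotient_meas (metric A) (Gamma_orbit r))%E.
Proof.
move=> GA.
pose E : set h := [set x | forall i, 0 < x i 0 < 1].
have bE : borel E.
  have -> : E = \bigcap_(i in [set: 'I_(n + n + 1)]) ((fun x : BV => (x : h) i 0) @^-1` `]0, 1[%classic).
    apply/seteqP; split => x /= xE; first by move=> i _ /=; rewrite in_itv; exact: xE.
    by move=> i; have := xE i I; rewrite /= in_itv.
  apply: (@fin_bigcap_measurable _ BV) => // i _; rewrite -[X in measurable X]setTI.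
  by apply: measurable_coord => //; exact: measurable_itv.
apply: ereal_sup_ubound; exists E.
  split=> // x y Ex Ey [g Gg gxy].
  have [gX gY gZ] := Gamma_integral hr Gg.
  have small (t a b : R) : 0 < a < 1 -> 0 < b < 1 -> t + a = b -> t \is a Num.int -> t = 0.
    move=> /andP[a0 a1] /andP[b0 b1] tab /intrP[m mE]; move: tab; rewrite mE => tab.
    have : (- 1)%:~R < m%:~R :> R by rewrite rmorphN /=; lra.
    have : m%:~R < 1%:~R :> R by rewrite /=; lra.
    by rewrite !ltr_int => ? ?; have -> : m = 0 by lia.
  have g0X i : g (iX i) 0 = 0.
    apply: (small _ _ _ (Ex (iX i)) (Ey (iX i))); first by rewrite -gxy hmul_X.
    exact: (integral_X hr) (Gamma_integral hr Gg).
  have g0Y i : g (iY i) 0 = 0.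
    by apply: (small _ _ _ (Ex (iY i)) (Ey (iY i))) => //; rewrite -gxy hmul_Y.
  have g0Z : g iZ 0 = 0.
    apply: (small _ _ _ (Ex iZ) (Ey iZ)).
      rewrite -gxy hmul_Z big1 ?mulr0 ?addr0// => i _.
      by rewrite g0X g0Y !mul0r subr0.
    by move: gZ; rewrite big1 ?mulr0 ?subr0// => i _; rewrite g0X mul0r.
  suff g0 : g = 0 by rewrite -gxy g0 hmul0x.
  apply/colP => i; rewrite [RHS]mxE; case: (split_ordP i) => k ->.
    by case: (split_ordP k) => l ->; [exact: g0X|exact: g0Y].
  by rewrite ord1; exact: g0Z.
rewrite volumeE//.
have -> : (fun x : h => (`|\det A.1 * A.2|^-1)%:E * (\1_E x)%:E)%E =
  (fun x : h => (`|\det A.1 * A.2|^-1)%:E * (\prod_i \1_`]0%R, 1%R[%classic (x i 0))%:E)%E.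
  apply/funext => x; congr (_ * _%:E)%E; rewrite [LHS]indicE.
  case: (boolP (x \in E)) => xE.
    by rewrite big1// => i _; rewrite indicE mem_set//= in_itv; move: xE; rewrite inE; exact.
  have [i xi] : exists i, ~~ (0 < x i 0 < 1).
    by move: xE; rewrite notin_setE => /existsNP[i /negP]; exists i.
  rewrite (bigD1 i)//= indicE memNset ?mul0r//= in_itv /=.
  exact/negP.
rewrite integralN_scale//.
- rewrite (@integralN_cube _ _ _ 1) ?expr1n ?mule1//.
  by rewrite lebesgue_measure_itv /= lte_fin ltr01 sube0.
- exact: measurable_cube.
- by move=> x; rewrite lee_fin prodr_ge0.
Qed.

End QuotientVolume.

(** * Length of curves and diameter of the quotient *)

Section VariationBound.
Context {R : realType}.
Local Notation leb := (@lebesgue_measure R).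

(** The integral of a nonnegative function is the supremum of those of the simple
    functions below it, so it is monotone for arbitrary functions; this lets the
    speed of a curve be compared with a measurable minorant. *)
Lemma ge0_integral_mono (f g : R -> \bar R) :
  (forall t, (0 <= f t)%E) -> (forall t, (f t <= g t)%E) ->
  (\int[leb]_t f t <= \int[leb]_t g t)%E.
Proof.
move=> f0 fg; have g0 t : (0 <= g t)%E by exact: le_trans (fg t).
rewrite !ge0_integralTE//; apply: le_ereal_sup => _ [u uf <-].
by exists u => // t; exact: le_trans (uf t) (fg t).
Qed.

Lemma increment_le_integral (psi : R -> R) a b : a < b ->
  (forall t, derivable psi t 1) -> continuous (derive1 psi) ->
  ((psi b - psi a)%:E <= \int[leb]_t (Num.max (derive1 psi t) 0 * \1_(`]a, b[%classic) t)%:E)%E.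
Proof.
move=> ab dpsi cpsi.
have mpsi : measurable_fun setT (derive1 psi) by exact: continuous_measurable_fun.
have cont : continuous psi.
  by move=> t; apply/differentiable_continuous/derivable1_diffP.
have FTC := @continuous_FTC2 R (derive1 psi) psi a b ab (continuous_subspaceT cpsi).
rewrite EFinB -FTC; last 2 first.
- split => [t _ //||].
    by apply: cvg_at_right_filter; exact: cont.
  by apply: cvg_at_left_filter; exact: cont.
- by [].
rewrite integralE.
apply: (@le_trans _ _ (\int[leb]_(t in `[a, b]) (fun t => (derive1 psi t)%:E)^\+ t)%E).
  rewrite -[leRHS]sube0; apply: leeB => //; apply: integral_ge0 => t _.
  exact: funeneg_ge0.
rewrite (@integral_itv_bndoo _ a b _ true false); last first.
  apply/measurable_funTS/measurable_funepos; exact/measurable_EFinP.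
rewrite integral_mkcond le_eqVlt; apply/orP; left; apply/eqP; apply: eq_integral => t _.
rewrite patchE indicE; case: ifP => _; last by rewrite mulr0.
by rewrite mulr1 funeposE EFin_max.
Qed.

(** On each open piece the minorant is the positive part of the derivative of the
    smooth extension [psi]. At the break points, where the derivative of [phi] may
    have no meaning, it is 0. *)
Lemma variation_minorant (F phi : R -> R) (a : R) (s : seq R) :
  (forall t, 0 <= F t) -> path <%R a s ->
  (forall i, (i < size s)%N -> exists psi : R -> R,
    [/\ forall t, derivable psi t 1, continuous (derive1 psi),
      phi (nth 0 (a :: s) i) = psi (nth 0 (a :: s) i),
      phi (nth 0 (a :: s) i.+1) = psi (nth 0 (a :: s) i.+1)
    & forall t, nth 0 (a :: s) i < t < nth 0 (a :: s) i.+1 -> derive1 psi t <= F t]) ->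
  exists g : R -> R, [/\ measurable_fun setT g, forall t, 0 <= g t,
    forall t, ~~ (a < t < last a s) -> g t = 0, forall t, g t <= F t
    & ((phi (last a s) - phi a)%:E <= \int[leb]_t (g t)%:E)%E].
Proof.
move=> F0; elim: s a => [|b s IH] a /=.
  move=> _ _; exists (fun=> 0); split => //.
  by rewrite subrr integral0_eq.
move=> /andP[ab bs] Hs.
have [g1 [mg1 g10 g1out g1F g1int]] := IH b bs (fun i => Hs i.+1).
have [psi [dpsi cpsi ea eb psiF]] := Hs 0%N isT; rewrite /= in ea eb psiF.
have bl : b <= last b s.
  by move: bs; rewrite path_sortedE; [move=> /andP[/allP bs _]|exact: lt_trans];
    have := mem_last b s; rewrite inE => /predU1P[->//|/bs/ltW].
pose g0 t := Num.max (derive1 psi t) 0 * \1_(`]a, b[%classic) t.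
have mg0 : measurable_fun setT g0.
  apply: measurable_funM; last exact: measurable_indic.
  by apply: measurable_maxr; [exact: continuous_measurable_fun|exact: measurable_cst].
have g00 t : 0 <= g0 t by rewrite mulr_ge0// le_max lexx orbT.
have g0out t : ~~ (a < t < b) -> g0 t = 0.
  by move=> atb; rewrite /g0 indicE memNset ?mulr0//= in_itv /=; exact/negP.
exists (fun t => g0 t + g1 t); split.
- exact: measurable_funD.
- by move=> t; rewrite addr_ge0.
- move=> t atl; rewrite g0out ?g1out ?addr0//.
    by apply: contra atl => /andP[bt ->]; rewrite (lt_trans ab bt).
  by apply: contra atl => /andP[-> tb]; rewrite (lt_le_trans tb bl).
- move=> t; have [atb|atb] := boolP (a < t < b).
    rewrite g1out ?addr0; last by case/andP: atb => _ tb; rewrite ltNge (ltW tb).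
    rewrite /g0 indicE mem_set ?mulr1//=.
    by rewrite ge_max psiF//=.
  by rewrite g0out// add0r.
have -> : (\int[leb]_t (g0 t + g1 t)%:E = \int[leb]_t (g0 t)%:E + \int[leb]_t (g1 t)%:E)%E.
  under eq_integral do rewrite EFinD.
  by rewrite ge0_integralD//; try (by move=> t _; rewrite lee_fin); exact/measurable_EFinP.
apply: le_trans (leeD (increment_le_integral ab dpsi cpsi) g1int).
by rewrite -EFinD lee_fin ea -eb; lra.
Qed.

End VariationBound.

Section LinearFunctional.
Context {R : realType} {N : nat}.
Variable l : 'I_N -> R.
Let L (u : 'cV[R]_N) : R := \sum_j l j * u j 0.

Lemma functional_derivative (f : R -> 'cV[R]_N) : (forall t, derivable f t 1) ->
  (forall t, derivable (fun t => L (f t)) t 1) /\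
  derive1 (fun t => L (f t)) = fun t => L (derive1 f t).
Proof.
move=> df.
pose h (j : 'I_N) : R -> R := l j \*: (fun t => f t j 0 : R).
have LE : (fun t => L (f t)) = \sum_j h j.
  by apply/funext => t; rewrite fct_sumE.
have dfj t j : derivable (fun t => f t j 0 : R) t 1 by exact: (derivable_mxP f t 1).1.
have dh t j : derivable (h j) t 1 by exact: derivableZ.
split=> [t|]; first by rewrite LE; exact: derivable_sum.
apply/funext => t; rewrite derive1E LE derive_sum//; apply: eq_bigr => j _.
rewrite deriveZ// derive1E derive_mx// mxE.
by [].
Qed.

Lemma functional_continuous : continuous L.
Proof.
apply: (@continuous_big R 'I_N +%R 0 predT) => [|j _ x].
  by move=> -[x y]; exact: add_continuous.
apply: (@continuousM R); first exact: cst_continuous.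
exact: coord_continuous.
Qed.

End LinearFunctional.

Section HeisenbergCurves.
Context {R : realType} {n : nat}.
Local Notation h := 'cV[R]_(n + n + 1).
Local Notation rmx := (map_mx (intr : int -> R)).
Implicit Types (A : 'M[R]_(n + n) * R) (p q : h).

(** The projection to v, in the coordinates given by the inverse of [A.1], does not
    increase the speed, and by the inequality of Cauchy and Schwarz neither does
    taking the component along the unit vector [e]. *)
Lemma curve_length_ge A (c : R -> h) (e : 'cV[R]_(n + n)) : GLR A -> piecewise_C1 c ->
  \sum_i e i 0 ^+ 2 = 1 ->
  ((\sum_i e i 0 * (invmx A.1 *m usubmx (c 1 - c 0)) i 0)%:E <= curve_length (metric A) c)%E.
Proof.
move=> GA [s0 [ss s00 s01 sC]] e1.
case: s0 => [|a s] in ss s00 s01 sC; first by move: s01 => /= /eqP; rewrite eq_sym oner_eq0.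
rewrite /= in s00 s01 ss; subst a.
pose lam : 'rV[R]_(n + n + 1) := e^T *m row_mx (invmx A.1) 0.
pose L (u : h) : R := \sum_j lam 0 j * u j 0.
have LE u : L u = \sum_i e i 0 * (invmx A.1 *m usubmx u) i 0.
  transitivity ((lam *m u) 0 0); first by rewrite [RHS]mxE.
  rewrite /lam -mulmxA -{1}[u]vsubmxK mul_row_col mul0mx addr0 mxE.
  by apply: eq_bigr => i _; rewrite [e^T _ _]mxE.
pose F t := Num.sqrt (form (metric A (c t)) (derive1 c t) (derive1 c t)).
have F0 t : 0 <= F t by exact: sqrtr_ge0.
have LF t : L (derive1 c t) <= F t.
  apply: le_trans (ler_norm _) _; rewrite -sqrtr_sqr; apply: ler_wsqrtr.
  rewrite form_metricE// form_gramE LE.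
  apply: le_trans (cauchy_schwarz _ _) _; rewrite e1 mul1r ler_wpDr//.
  by rewrite mulr_ge0 ?invr_ge0 ?sqr_ge0// -expr2 sqr_ge0.
have Lsub u v : L (u - v) = L u - L v.
  by rewrite -sumrB; apply: eq_bigr => j _; rewrite !mxE mulrBr.
rewrite -LE Lsub.
have [g [mg g0 gout gF gint]] : exists g : R -> R, [/\ measurable_fun setT g, forall t, 0 <= g t,
    forall t, ~~ (0 < t < last 0 s) -> g t = 0, forall t, g t <= F t
    & ((L (c (last 0 s)) - L (c 0))%:E <= \int[lebesgue_measure]_t (g t)%:E)%E].
  apply: (@variation_minorant R F (fun t => L (c t))) => // i si.
  have [f [df cf fE]] := sC i si.
  have [dLf LfE] := functional_derivative (fun j => lam 0 j) df.
  have lt_i : nth 0 (0 :: s) i < nth 0 (0 :: s) i.+1.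
    exact: (pathP 0 ss).
  exists (fun t => L (f t)); split.
  - exact: dLf.
  - rewrite LfE => t.
    exact: (@continuous_comp _ _ _ (derive1 f) L t (cf t) (@functional_continuous _ _ _ _)).
  - by congr L; apply: fE; rewrite lexx ltW.
  - by congr L; apply: fE; rewrite lexx ltW.
  - move=> t tin; rewrite LfE.
    suff <- : derive1 c t = derive1 f t by exact: LF.
    rewrite !derive1E; apply: near_eq_derive.
    have : t \in `](nth 0 (0 :: s) i), (nth 0 (0 :: s) i.+1)[ by rewrite in_itv.
    move/near_in_itvoo; apply: filterS => u; rewrite in_itv /= => /andP[u1 u2].
    by apply: fE; rewrite !ltW.
rewrite s01 in gout gint; apply: le_trans gint _.
rewrite /curve_length [leRHS]integral_mkcond; apply: ge0_integral_mono => t; first by rewrite lee_fin.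
rewrite patchE; case: ifPn => tin; first by rewrite lee_fin; exact: gF.
rewrite gout//; apply: contra tin => /andP[t0 t1].
by rewrite inE /= in_itv /= !ltW.
Qed.

(** The translate by [p] of the one-parameter group [t *: U] is an affine line in the
    coordinates, since the bracket is linear in [t], and it has constant speed. *)
Lemma quotient_dist_le A (r : n.-tuple nat) p q (g : h) : GLR A -> Gamma r g ->
  (quotient_dist (metric A) (Gamma_orbit r) p q <=
   (normA A (hmul (hinv p) (hmul g q)))%:E)%E.
Proof.
move=> GA Gg; set U := hmul (hinv p) (hmul g q).
pose W := U + 2^-1 *: bracket p U.
pose c (t : R) : h := p + t *: W.
have cE (t : R) : c t = hmul p (t *: U).
  rewrite /c /W hmulE bracketE formZr; clearbody U.
  by apply/matrixP => i j; rewrite !mxE; ring.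
have cq t x : c (x *: (1 : R^o) + t) = c t + x *: W + x ^+ 2 *: 0.
  rewrite scaler0 addr0 /c scalerDl addrA [x *: 1](mulr1 x).
  by rewrite [p + _ + _]addrAC.
have dc t : derive1 c t = W by rewrite derive1E; exact: (derive_quadratic (cq t)).
apply: ereal_inf_lbound; exists c; first split.
- exists [:: 0; 1]; split => //=; first by rewrite ltr01.
  case=> [|[]]// _; exists c; split => //.
    by move=> t; exact: (derivable_quadratic (cq t)).
  by rewrite (_ : derive1 c = cst W); [exact: cst_continuous|apply/funext].
- exists 0; first by have [] := @Gamma_subgroup R n r.
  by rewrite hmul0x /c scale0r addr0.
- exists g => //; rewrite cE scale1r /U -hmulA hmul_hinv hmul0x //.
rewrite /curve_length -[RHS]mule1.
under eq_integral => t _.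
  rewrite dc form_metric.
  have -> : left_mx (c t) *m W = U.
    rewrite left_mxE bracketE /c formDl formZl form_skew0 ?tr_Jext// mulr0 addr0.
    rewrite /W bracketE formDr !formZr -basisZE -[form Jext p basisZ]mul1r -formZr form_Jext_z !mulr0 addr0.
    by rewrite addrK.
  over.
by rewrite integral_cst//= lebesgue_measure_itv /= lte_fin ltr01 sube0.
Qed.

(** A curve of length less than [D + 1] joins the orbit of 0 to the orbit of a lift of
    [w]; the displacement of its projection is [w] plus a lattice vector. The 1 is
    there because the distance is an infimum. *)
Lemma covering_of_diam A (r : n.-tuple nat) (D : R) : Dset r -> GLR A -> 0 < D ->
  (quotient_diam (metric A) (Gamma_orbit r) <= D%:E)%E ->
  forall w : 'cV[R]_(n + n), exists z : 'cV[int]_(n + n),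
    form ((diag_r r)^T *m gram A *m diag_r r) (w + rmx z) (w + rmx z) <= (D + 1) ^+ 2.
Proof.
move=> hr GA D0 diam w; pose q : h := col_mx (diag_r r *m w) 0.
have : (quotient_dist (metric A) (Gamma_orbit r) 0 q < (D + 1)%:E)%E.
  apply: (@le_lt_trans _ _ D%:E); last by rewrite lte_fin; lra.
  by apply: le_trans diam; apply: ereal_sup_ubound; exists (0, q).
move/ereal_inf_lt => [_ [c [cC [g Gg c0] [g' Gg' c1]] <-]] len.
have [a aE] := integral_coords_v hr (Gamma_integral hr Gg).
have [a' a'E] := integral_coords_v hr (Gamma_integral hr Gg').
have dE : usubmx (c 1 - c 0) = diag_r r *m (w + rmx (a' - a)).
  rewrite linearB /= -c0 -c1 !hmul_v aE a'E [usubmx 0]linear0 addr0 col_mxKu.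
  by rewrite map_mxB !mulmxDr mulmxN addrAC addrC addrA addrC addrA.
exists (a' - a); rewrite form_congr -dE form_gramE.
set y := invmx A.1 *m usubmx (c 1 - c 0).
set s := \sum_i y i 0 ^+ 2.
have s0 : 0 <= s by apply: sumr_ge0 => i _; exact: sqr_ge0.
have [->|sn0] := eqVneq s 0; first exact: sqr_ge0.
have sq0 : 0 < Num.sqrt s by rewrite sqrtr_gt0 lt0r sn0.
have e1 : \sum_i ((Num.sqrt s)^-1 *: y) i 0 ^+ 2 = 1.
  under eq_bigr do rewrite mxE exprMn.
  by rewrite -mulr_sumr -/s exprVn sqr_sqrtr// mulVf.
have := le_lt_trans (curve_length_ge GA cC e1) len.
under eq_bigr do rewrite -/y mxE -mulrA -expr2.
rewrite -mulr_sumr -/s -{2}(sqr_sqrtr s0) expr2 mulKf ?gt_eqF// lte_fin => ?.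
rewrite -(sqr_sqrtr s0); apply: lerXn2r; rewrite ?nnegrE; lra.
Qed.

Lemma det_diag_r (r : n.-tuple nat) : \det (diag_r r : 'M[R]_(n + n)) = \prod_i (tnth r i)%:R.
Proof.
rewrite det_diag big_split_ord /= [X in _ * X]big1 ?mulr1 => [|i _]; last first.
  by rewrite row_mxEr mxE.
by apply: eq_bigr => i _; rewrite row_mxEl mxE.
Qed.

Lemma diag_r_unit (r : n.-tuple nat) : Dset r -> (diag_r r : 'M[R]_(n + n)) \in unitmx.
Proof.
move=> hr; rewrite unitmxE unitfE det_diag_r; apply/prodf_neq0 => i _.
exact/lt0r_neq0/r_gt0.
Qed.

(** A lattice element brings the v-part of the displacement from [p] to [q] within
    the covering radius, and then a central one brings its Z-part into [0, 1]. *)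
Lemma diam_of_covering A (r : n.-tuple nat) (c : R) : Dset r -> GLR A ->
  (forall w : 'cV[R]_(n + n), exists z : 'cV[int]_(n + n),
    form ((diag_r r)^T *m gram A *m diag_r r) (w + rmx z) (w + rmx z) <= c) ->
  (quotient_diam (metric A) (Gamma_orbit r) <= (Num.sqrt (c + A.2 ^- 2))%:E)%E.
Proof.
move=> hr GA cov; apply: ge_ereal_sup => _ [[p q] _ <-] /=.
have du := diag_r_unit hr.
have [z zP] := cov (invmx (diag_r r) *m (usubmx q - usubmx p)).
have [g Gg gv] := @zlattice_diag R n r z.
pose U0 : h := hmul (hinv p) (hmul g q).
pose k := - Num.floor (U0 iZ 0).
have Gk := @Gamma_central R n r k.
have [_ GM _] := @Gamma_subgroup R n r.
apply: le_trans (quotient_dist_le p q GA (GM _ _ Gg Gk)) _.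
rewrite lee_fin; apply: ler_wsqrtr; rewrite innerE//.
have -> : hmul (hinv p) (hmul (hmul g (k%:~R *: basisZ)) q) = U0 + k%:~R *: basisZ.
  rewrite -hmul_central /U0 !hmulA; congr (hmul _ (hmul _ _)).
  by rewrite !hmulE form_z_Jext form_Jext_z !mulr0 !scale0r !addr0 addrC.
have -> : usubmx (U0 + k%:~R *: basisZ) = diag_r r *m (invmx (diag_r r) *m (usubmx q - usubmx p) + rmx z).
  rewrite linearD linearZ /= basisZE ezE col_mxKu scaler0 addr0 !hmul_v /hinv linearN /=.
  by rewrite mulmxDr mulKVmx// -gv addrC -addrA addrC.
rewrite -form_congr; apply: lerD => //.
rewrite ler_piMr ?invr_ge0 ?sqr_ge0//.
have : 0 <= (U0 + k%:~R *: basisZ) iZ 0 <= 1.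
  have -> : (U0 + k%:~R *: basisZ) iZ 0 = U0 iZ 0 + k%:~R.
    by rewrite [LHS]mxE; congr (_ + _); rewrite !mxE !eqxx mulr1.
  rewrite /k rmorphN /=; have := floor_le (U0 iZ 0); have := floorD1_gt (U0 iZ 0); rewrite rmorphD /=; lra.
by move=> /andP[? ?]; nra.
Qed.

End HeisenbergCurves.

(** * The invariants of a metric in terms of its Gram matrix *)

Section Invariants.
Context {R : realType} {n : nat}.
Local Notation v := 'cV[R]_(n + n).
Local Notation h := 'cV[R]_(n + n + 1).
Local Notation J := (@Jmx R n).
Local Notation rmx := (map_mx (intr : int -> R)).
Local Notation cmx := (map_mx (real_complex R)).
Implicit Types (A : 'M[R]_(n + n) * R) (d : n.-tuple R).

Definition lattice_gram (r : n.-tuple nat) A : 'M[R]_(n + n) :=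
  (diag_r r)^T *m gram A *m diag_r r.

Lemma gram_inv A : GLR A -> gram A *m (A.1 *m A.1^T) = 1%:M.
Proof.
move=> [Bu _]; rewrite /gram -mulmxA (mulmxA (invmx _)) mulVmx// mul1mx.
by rewrite -trmx_mul mulmxV// trmx1.
Qed.

Lemma gram_sym A : (gram A)^T = gram A.
Proof. by rewrite /gram trmx_mul trmxK. Qed.

Lemma is_jP A (j : 'M[R]_(n + n)) : GLR A -> is_j A j <-> j = - (A.1 *m A.1^T *m J).
Proof.
move=> GA.
have jE : is_j A j <-> j^T *m gram A = J.
  have inner_v (a b : v) : inner A (of_v a) (of_v b) = form (gram A) a b.
    by rewrite innerE// /of_v !col_mxKu /iZ !col_mxEd !mxE mul0r mulr0 addr0.
  have bracket_v (a b : v) : omega (bracket (of_v a) (of_v b)) = form J a b.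
    by rewrite bracketE /omega !mxE !eqxx mulr1 form_Jext /of_v !col_mxKu.
  split=> [ij|jJ U V]; last first.
    by rewrite inner_v bracket_v -jJ /Defs.form trmx_mul !mulmxA.
  apply/matrixP => a b; rewrite -!form_delta -bracket_v -ij inner_v.
  by rewrite /Defs.form trmx_mul !mulmxA.
have inv2 : (A.1 *m A.1^T) *m gram A = 1%:M by apply: mulmx1C; exact: gram_inv.
rewrite jE; split=> [jJ|->]; last first.
  by rewrite linearN /= !trmx_mul trmxK tr_Jmx !mulNmx opprK -mulmxA inv2 mulmx1.
rewrite -[j]mul1mx -inv2 -!mulmxA -mulmxN -mulmxN; congr (_ *m (_ *m _)).
by rewrite mulmxA -tr_Jmx -jJ trmx_mul trmxK gram_sym.
Qed.

(** The operator [j_A] is [- B B^T J], and conjugation by [B] turns it into the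
    transpose of [B^T J B], for [B = A.1]. *)
Lemma is_dvalsP A d : GLR A -> is_dvals A d <->
  [/\ all (fun t => 0 < t) d, sorted <=%R d &
    char_poly (cmx (skew A)) =
    \prod_(t <- d) (('X - (Complex 0 t)%:P) * ('X - (Complex 0 (- t))%:P))].
Proof.
move=> GA; have [Bu _] := GA.
have cE : char_poly (cmx (- (A.1 *m A.1^T *m J))) = char_poly (cmx (skew A)).
  have -> : - (A.1 *m A.1^T *m J) = invmx (invmx A.1) *m (skew A)^T *m invmx A.1.
    by rewrite invmxK tr_skew /skew mulmxN mulNmx -!mulmxA mulmxV// mulmx1.
  rewrite -[LHS]map_char_poly -[RHS]map_char_poly.
  by rewrite (char_poly_similar _ (P := invmx A.1)) ?unitmx_inv// char_poly_tr.
split=> [[d0 ds [j /(is_jP _ GA) -> jc]]|[d0 ds dc]]; first by split; [exact: d0|exact: ds|rewrite -cE; exact: jc].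
split; [exact: d0|exact: ds|]; exists (- (A.1 *m A.1^T *m J)); first exact/(is_jP _ GA).
by rewrite cE; exact: dc.
Qed.

Lemma skew_unit A : GLR A -> skew A \in unitmx.
Proof.
move=> [Bu _]; rewrite /skew !unitmx_mul unitmx_tr Bu andbT /=.
by case: (mulmx1_unit (@mul_Jmx_tr R n)).
Qed.

Lemma det_skew A d : GLR A -> is_dvals A d -> \prod_(t <- d) t ^+ 2 = \det A.1 ^+ 2.
Proof.
move=> GA /(is_dvalsP _ GA)[d0 ds dc].
have [dE _] := skew_eigenvalues (tr_skew A) dc; rewrite -dE.
have [Bu _] := GA.
have kE : \det (skew A) = \det A.1 ^+ 2 * \det J.
  by rewrite /skew !det_mulmx det_tr mulrAC expr2.
have J2 : \det J ^+ 2 = 1.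
  by have := congr1 determinant (@mul_Jmx_tr R n); rewrite det_mulmx det_tr det1 expr2.
(* The product of squares is nonnegative, which makes [\det J] equal to 1. *)
have k0 : 0 <= \det (skew A).
  by rewrite dE prodr_ge0// => t _; exact: sqr_ge0.
have B0 : 0 < \det A.1 ^+ 2.
  by rewrite lt0r sqr_ge0 sqrf_eq0 -unitfE -unitmxE Bu.
have J0 : 0 <= \det J by move: k0; rewrite kE pmulr_rge0.
have -> : \det (skew A) = \det A.1 ^+ 2 * 1; last by rewrite mulr1.
by rewrite kE; congr (_ * _); apply/eqP; rewrite -(@eqrXn2 _ 2)// expr1n J2.
Qed.

Lemma sum_skew A d : GLR A -> is_dvals A d ->
  \sum_i \sum_j skew A i j ^+ 2 = 2 * \sum_(t <- d) t ^+ 2.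
Proof.
move=> GA /(is_dvalsP _ GA)[d0 ds dc].
have [_ <-] := skew_eigenvalues (tr_skew A) dc.
by rewrite trace_skew_sqr ?tr_skew// opprK.
Qed.

Lemma dvals_exist A : GLR A -> exists d, is_dvals A d.
Proof.
move=> GA; have [d dP] := skew_eigenvalue_pairs (tr_skew A) (skew_unit GA).
by exists d; apply/(is_dvalsP _ GA).
Qed.

Lemma lattice_gram_sym r A : (lattice_gram r A)^T = lattice_gram r A.
Proof.
rewrite /lattice_gram; have := gram_sym A; move: (gram A) => G GT.
by rewrite !trmx_mul trmxK GT mulmxA.
Qed.

Lemma lattice_gram_coercive (r : n.-tuple nat) A : Dset r -> GLR A -> coercive (lattice_gram r A).
Proof.
move=> hr [Bu _]; apply: coercive_congr; first exact: diag_r_unit.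
rewrite /gram -[X in X *m _]mulmx1; apply: coercive_congr; last exact: coercive1.
by rewrite unitmx_inv.
Qed.

Lemma det_lattice_gram r A :
  \det (lattice_gram r A) = (\prod_i (tnth r i)%:R) ^+ 2 / \det A.1 ^+ 2.
Proof.
rewrite /lattice_gram /gram !det_mulmx !det_tr det_inv det_diag_r -exprVn; ring.
Qed.

Lemma normA_v A (U : v) : GLR A -> normA A (of_v U) = Num.sqrt (form (gram A) U U).
Proof.
by move=> GA; rewrite /normA innerE// /of_v !col_mxKu /iZ !col_mxEd !mxE mul0r mulr0 addr0.
Qed.

Lemma min_norm_le (r : n.-tuple nat) A (z : 'cV[int]_(n + n)) : Dset r -> GLR A -> z != 0 ->
  min_norm r A <= Num.sqrt (form (lattice_gram r A) (rmx z) (rmx z)).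
Proof.
move=> hr GA z0; apply: ge_inf.
  by exists 0 => _ [U _ <-]; exact: sqrtr_ge0.
exists (diag_r r *m rmx z); last by rewrite normA_v// -form_congr.
split; first exact: zlattice_diag.
move=> /= /(congr1 (mulmx (invmx (diag_r r)))); rewrite mulKmx ?diag_r_unit// mulmx0.
move=> zz; case/eqP: z0; apply/matrixP => i j; move/matrixP/(_ i j): zz; rewrite !mxE.
by move/eqP; rewrite intr_eq0 => /eqP.
Qed.

Lemma le_min_norm (r : n.-tuple nat) A c : (0 < n)%N -> Dset r -> GLR A ->
  (forall z : 'cV[int]_(n + n), z != 0 -> c <= form (lattice_gram r A) (rmx z) (rmx z)) ->
  Num.sqrt c <= min_norm r A.
Proof.
move=> n0 hr GA cP; apply: lb_le_inf.
  exists (normA A (of_v (diag_r r *m rmx (const_mx 1)))).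
  exists (diag_r r *m rmx (const_mx 1)) => //; split; first exact: zlattice_diag.
  move=> /= /(congr1 (mulmx (invmx (diag_r r)))); rewrite mulKmx ?diag_r_unit// mulmx0.
  have i0 : (0 < n + n)%N by rewrite addn_gt0 n0.
  by move/matrixP/(_ (Ordinal i0) 0); rewrite !mxE => /eqP; rewrite oner_eq0.
move=> _ [U [/(zlatticeP hr)[z ->] U0] <-].
rewrite normA_v// -form_congr; apply: ler_wsqrtr; apply: cP.
apply: contra_not_neq U0 => -> /=; by rewrite map_mx0 mulmx0.
Qed.

Lemma dvals_le_last d (t : R) : sorted <=%R d -> t \in (d : seq R) -> t <= d`_n.-1.
Proof.
move=> ds td; have [i i_n <-] := elimT (nthP 0) td; rewrite size_tuple in i_n.
apply: (sorted_leq_nth le_trans le_refl 0 ds); rewrite ?inE ?size_tuple//; lia.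
Qed.

End Invariants.

(** * The equivalence *)

Section Equivalence.
Context {R : realType} {n : nat}.
Local Notation rmx := (map_mx (intr : int -> R)).
Implicit Types (A : 'M[R]_(n + n) * R) (r : n.-tuple nat) (d : n.-tuple R).

(** The term of the Z-direction is nonnegative, and the Frobenius norm bounds the
    operator norm in the other term. *)
Lemma ricci_ge_of_skew A (K : R) : GLR A ->
  A.2 ^- 2 / 2 * (\sum_i \sum_j skew A i j ^+ 2) <= - K -> ricci_ge (metric A) K.
Proof.
move=> GA AK x u; rewrite form_metricE// form_gramE form_ricci// => unit_u.
set w := invmx A.1 *m usubmx u in unit_u *.
set F := \sum_i \sum_j _ in AK *.
have s0 : 0 <= A.2 ^- 2 by rewrite invr_ge0 sqr_ge0.
have F0 : 0 <= F by apply: sumr_ge0 => i _; apply: sumr_ge0 => j _; exact: sqr_ge0.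
set a := (_ 0 0) in unit_u *.
have w1 : \sum_i w i 0 ^+ 2 <= 1 by rewrite -unit_u ler_wpDr// mulr_ge0// -expr2 sqr_ge0.
have kw : \sum_i (skew A *m w) i 0 ^+ 2 <= F.
  rewrite /F; apply: ler_sum => i _; rewrite mxE.
  apply: le_trans (cauchy_schwarz (skew A i) (w ^~ 0)) _.
  by rewrite ler_piMr// sumr_ge0// => j _; exact: sqr_ge0.
have c0 : 0 <= A.2 ^- 2 ^+ 2 / 4 * F * a ^+ 2.
  by rewrite mulr_ge0 ?sqr_ge0// mulr_ge0// divr_ge0 ?sqr_ge0.
have := ler_wpM2l (divr_ge0 s0 (ler0n R 2)) kw.
lra.
Qed.

(** At the origin the columns of [A.1] are orthonormal vectors of v; the bounds for the
    Ricci curvature in these directions add up to the Frobenius norm. *)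
Lemma skew_of_ricci_ge A (K : R) : GLR A -> ricci_ge (metric A) K ->
  \sum_i \sum_j skew A i j ^+ 2 <= (n + n)%:R * (2 * `|K| * A.2 ^+ 2).
Proof.
move=> GA AK; have [Bu r0] := GA.
have -> : (n + n)%:R * (2 * `|K| * A.2 ^+ 2) = \sum_(j < n + n) (2 * `|K| * A.2 ^+ 2).
  by rewrite sumr_const card_ord mulr_natl.
rewrite exchange_big /=.
apply: ler_sum => j _.
pose bv := A.1 *m delta_mx j 0 : 'cV[R]_(n + n).
have [u [uv ua]] : exists u : 'cV[R]_(n + n + 1), usubmx u = bv /\ ((alpha 0)^T *m u) 0 0 = 0.
  exists (col_mx bv 0); rewrite col_mxKu; split=> //.
  by rewrite /alpha mulmx0 scaler0 addr0 trmx_delta -rowE mxE /iZ col_mxEd mxE.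
have := AK 0 u; rewrite form_metricE// form_gramE form_ricci// ua uv /bv mulKmx//.
rewrite -colE !mulr0 addr0 expr0n mulr0 addr0.
have -> : \sum_i (delta_mx j 0 : 'cV[R]_(n + n)) i 0 ^+ 2 = 1.
  rewrite (bigD1 j)//= mxE !eqxx expr1n big1 ?addr0// => i ij.
  by rewrite mxE (negPf ij) expr0n.
have -> : \sum_i col j (skew A) i 0 ^+ 2 = \sum_i skew A i j ^+ 2.
  by apply: eq_bigr => i _; rewrite mxE.
move=> /(_ erefl); set X := \sum_i skew A i j ^+ 2 => KX.
have r2 : 0 < A.2 ^+ 2 by rewrite lt0r sqr_ge0 sqrf_eq0 r0.
have -> : X = A.2 ^- 2 / 2 * X * (2 * A.2 ^+ 2) by field; rewrite r0.
rewrite [2 * `|K|]mulrC -[leRHS]mulrA ler_pM2r; last exact: mulr_gt0.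
by have := ler_norm (- K); rewrite normrN; lra.
Qed.

Lemma sqr_le_sqr (a b : R) : 0 <= a -> a <= b -> a ^+ 2 <= b ^+ 2.
Proof. by move=> a0 ab; rewrite lerXn2r ?nnegrE// (le_trans a0). Qed.

Lemma le_of_sqr (a b : R) : 0 <= b -> a ^+ 2 <= b ^+ 2 -> a <= b.
Proof.
move=> b0 ab; apply: le_trans (ler_norm a) _.
by rewrite -[b]ger0_norm// -!sqrtr_sqr ler_wsqrtr.
Qed.

Lemma sqrt_le (x a : R) : 0 <= a -> x <= a ^+ 2 -> Num.sqrt x <= a.
Proof. by move=> a0 xa; rewrite -[a]ger0_norm// -sqrtr_sqr ler_wsqrtr. Qed.

Lemma le_sqrt (x a : R) : 0 <= a -> a ^+ 2 <= x -> a <= Num.sqrt x.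
Proof. by move=> a0 xa; rewrite -[a]ger0_norm// -sqrtr_sqr ler_wsqrtr. Qed.

Lemma sum_sqr_le d (c : R) : (forall t, t \in (d : seq R) -> 0 < t <= c) ->
  \sum_(t <- d) t ^+ 2 <= n%:R * c ^+ 2.
Proof.
move=> dc; rewrite big_tuple.
have -> : n%:R * c ^+ 2 = \sum_(i < n) c ^+ 2 by rewrite sumr_const card_ord mulr_natl.
apply: ler_sum => i _; have /andP[t0 tc] := dc _ (mem_tnth i d).
by apply: sqr_le_sqr => //; exact: ltW.
Qed.

Lemma prod_sqr_le d (c : R) : (forall t, t \in (d : seq R) -> 0 < t <= c) ->
  \prod_(t <- d) t ^+ 2 <= (c ^+ 2) ^+ n.
Proof.
move=> dc; rewrite big_tuple -prodr_const_ord; apply: ler_prod => i _.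
have /andP[t0 tc] := dc _ (mem_tnth i d).
by rewrite sqr_ge0 sqr_le_sqr// ltW.
Qed.

Lemma sqr_le_sum d (t : R) : t \in (d : seq R) -> t ^+ 2 <= \sum_(s <- d) s ^+ 2.
Proof.
move=> td; rewrite (big_rem t)//= ler_wpDr// sumr_ge0// => s _; exact: sqr_ge0.
Qed.

End Equivalence.

Local Notation rmx := (map_mx intr).

Theorem proposition1p2 (R : realType) (n : nat) (hn : (1 <= n)%N)
    (r : n.-tuple nat) (hr : Dset r)
    (X : set (set ('M[R]_(n + n) * R))) (hX : X `<=` moduli r) :
  (exists C1 C2 C3 Cm Cp : R,
    [/\ 0 < C1, 0 < C2, 0 < C3, 0 < Cm & 0 < Cp] /\
    forall A : 'M[R]_(n + n) * R, GLR A -> X (dclass r A) ->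
      [/\ C1 <= min_norm r A,
          C2 <= `|\det A.1|,
          (exists2 d : n.-tuple R, is_dvals A d & d`_n.-1 <= C3)
        & Cm <= `|A.2| <= Cp])
  <->
  (exists D V K : R,
    [/\ 0 < D & 0 < V] /\
    forall A : 'M[R]_(n + n) * R, GLR A -> X (dclass r A) ->
      [/\ (quotient_diam (metric A) (Gamma_orbit r) <= D%:E)%E,
          (V%:E <= quotient_meas (metric A) (Gamma_orbit r))%E
        & ricci_ge (metric A) K]).
Proof.
have m0 : (0 < n + n)%N by rewrite addn_gt0 hn.
set m := (n + n)%N in m0.
pose p : R := \prod_i (tnth r i)%:R.
have p0 : 0 < p by rewrite prodr_gt0// => i _; exact: r_gt0.
split.
- move=> [C1 [C2 [C3 [Cm [Cp [[C10 C20 C30 Cm0 Cp0] H]]]]]].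
  (* Bounds for the weights of the lattice from below, and for its determinant from
     above. *)
  pose del := C1 ^+ 2 / 4 ^+ m; pose M := p ^+ 2 / C2 ^+ 2.
  have del0 : 0 < del by rewrite divr_gt0 ?exprn_gt0.
  pose c := m%:R * (M / del ^+ m.-1).
  pose V := (p / Num.sqrt (del ^+ m) * Cp)^-1.
  exists (1 + Num.sqrt (c + Cm ^- 2)), V, (- (Cm ^- 2 * (n%:R * C3 ^+ 2))).
  split.
    split; first by rewrite ltr_wpDr ?sqrtr_ge0.
    by rewrite invr_gt0 mulr_gt0// divr_gt0// sqrtr_gt0 exprn_gt0.
  move=> A GA XA; have [A1 A2 [d dA dC3] /andP[A4 A5]] := H A GA XA.
  have [Bu r0] := GA.
  have B0 : 0 < `|\det A.1| by rewrite normr_gt0 -unitfE -unitmxE.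
  have rho0 : 0 < `|A.2| by rewrite normr_gt0.
  have detB2 : 0 < \det A.1 ^+ 2 by rewrite -real_normK ?num_real// exprn_gt0.
  have sys (z : 'cV[int]_(n + n)) : z != 0 -> C1 ^+ 2 <= form (lattice_gram r A) (rmx z) (rmx z).
    move=> z0; have C1z := le_trans A1 (min_norm_le hr GA z0).
    have F0 := lt_le_trans C10 C1z; rewrite sqrtr_gt0 in F0.
    by rewrite -(sqr_sqrtr (ltW F0)); apply: sqr_le_sqr => //; exact: ltW.
  have Gs := lattice_gram_sym r A; have Gc := lattice_gram_coercive hr GA.
  have detM : \det (lattice_gram r A) <= M.
    rewrite det_lattice_gram ler_wpM2l ?sqr_ge0// -[\det A.1 ^+ 2]real_normK ?num_real//.
    by rewrite lef_pV2 ?posrE ?exprn_gt0// sqr_le_sqr// ltW.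
  have C12 : 0 < C1 ^+ 2 by rewrite exprn_gt0.
  have cov := covering_of_systole Gs Gc m0 C12 sys detM.
  have det_ge := det_ge_of_systole Gs Gc m0 C12 sys.
  split.
  + apply: le_trans (diam_of_covering hr GA cov) _; rewrite lee_fin -[leLHS]add0r lerD//.
    apply: ler_wsqrtr; rewrite lerD2l -real_normK ?num_real//.
    by rewrite lef_pV2 ?posrE ?exprn_gt0// sqr_le_sqr// ltW.
  + apply: le_trans (quotient_meas_ge hr GA); rewrite lee_fin normrM.
    have sd0 : 0 < Num.sqrt (del ^+ m) by rewrite sqrtr_gt0 exprn_gt0.
    rewrite lef_pV2 ?posrE ?mulr_gt0 ?invr_gt0//.
    apply: ler_pM => //; rewrite ler_pdivlMr//.
    apply: le_of_sqr; first exact: ltW.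
    rewrite exprMn sqr_sqrtr; last by rewrite exprn_ge0// ltW.
    rewrite real_normK ?num_real// mulrC -ler_pdivlMr ?detB2//.
    by rewrite -det_lattice_gram.
  + apply: ricci_ge_of_skew => //; rewrite opprK (sum_skew GA dA).
    have [d_pos d_sorted _] := dA.
    have dC t : t \in (d : seq R) -> 0 < t <= C3.
      by move=> td; rewrite (allP d_pos)//=; apply: le_trans dC3; exact: dvals_le_last.
    have -> : forall a b : R, a / 2 * (2 * b) = a * b by move=> a b; field.
    apply: ler_pM; rewrite ?invr_ge0 ?sqr_ge0//; last exact: sum_sqr_le.
      by apply: sumr_ge0 => t _; exact: sqr_ge0.
    have r2 : 0 < A.2 ^+ 2 by rewrite -real_normK ?num_real// exprn_gt0.
    have Cm2 : 0 < Cm ^+ 2 by rewrite exprn_gt0.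
    by rewrite lef_pV2 ?posrE// -[A.2 ^+ 2]real_normK ?num_real// sqr_le_sqr// ltW.
- move=> [D [V [K [[D0 V0] H]]]].
  (* An upper bound for the weights of a lattice with covering radius [D + 1]. *)
  pose rad := 4 ^+ m * (4 * (D + 1) ^+ 2).
  have rad0 : 0 < rad by rewrite mulr_gt0 ?exprn_gt0// mulr_gt0// exprn_gt0; lra.
  pose C2 := p / Num.sqrt (rad ^+ m).
  have C20 : 0 < C2 by rewrite divr_gt0// sqrtr_gt0 exprn_gt0.
  (* A lower bound for [d_n ^+ 2]: its power [n] is at least the product of the
     [d_j ^+ 2], which is [\det B ^+ 2]. The minimum with 1 replaces a root. *)
  pose mu := Num.min 1 (C2 ^+ 2); pose k1 := m%:R * (`|K| + 1).
  have mu0 : 0 < mu by rewrite lt_min ltr01 exprn_gt0.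
  have k10 : 0 < k1 by rewrite mulr_gt0 ?ltr0n// ltr_wpDl.
  pose Cm := Num.sqrt (mu / k1).
  have Cm0 : 0 < Cm by rewrite sqrtr_gt0 divr_gt0.
  pose Lam := (2 * p) ^+ (n + n + 1).
  have Lam0 : 0 < Lam by rewrite exprn_gt0// mulr_gt0.
  pose Cp := Lam / (V * C2); pose Bm := Lam / (V * Cm).
  have Cp0 : 0 < Cp by rewrite divr_gt0// mulr_gt0.
  have Bm0 : 0 < Bm by rewrite divr_gt0// mulr_gt0.
  pose del := p ^+ 2 / Bm ^+ 2.
  have del0 : 0 < del by rewrite divr_gt0 ?exprn_gt0.
  exists (Num.sqrt (del / rad ^+ m.-1)), C2, (Num.sqrt (k1 * Cp ^+ 2)), Cm, Cp.
  split.
    split=> //; first by rewrite sqrtr_gt0 divr_gt0 ?exprn_gt0.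
    by rewrite sqrtr_gt0 mulr_gt0 ?exprn_gt0.
  move=> A GA XA; have [diam vol ric] := H A GA XA.
  have [Bu r0] := GA.
  have B0 : 0 < `|\det A.1| by rewrite normr_gt0 -unitfE -unitmxE.
  have rho0 : 0 < `|A.2| by rewrite normr_gt0.
  have Gs := lattice_gram_sym r A; have Gc := lattice_gram_coercive hr GA.
  have cov := covering_of_diam hr GA D0 diam.
  have detB2 : 0 < \det A.1 ^+ 2 by rewrite -real_normK ?num_real// exprn_gt0.
  have C2B : C2 <= `|\det A.1|.
    have := det_le_of_covering Gs Gc m0 cov; rewrite -/rad det_lattice_gram.
    rewrite ler_pdivrMr// -[\det A.1 ^+ 2]real_normK ?num_real// => pQ.
    rewrite ler_pdivrMr ?sqrtr_gt0 ?exprn_gt0//.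
    apply: le_of_sqr; first by rewrite mulr_ge0// sqrtr_ge0.
    rewrite exprMn sqr_sqrtr; last by rewrite exprn_ge0// ltW.
    by rewrite mulrC.
  have [d dA] := dvals_exist GA.
  have [d_pos d_sorted _] := dA.
  have lst : d`_n.-1 \in (d : seq R) by rewrite mem_nth// size_tuple prednK.
  have dle t : t \in (d : seq R) -> 0 < t <= d`_n.-1.
    by move=> td; rewrite (allP d_pos)//=; exact: dvals_le_last.
  have sumd : \sum_(t <- d) t ^+ 2 <= k1 * A.2 ^+ 2.
    have := skew_of_ricci_ge GA ric; rewrite (sum_skew GA dA) => sk.
    apply: (@le_trans _ _ (m%:R * (`|K| * A.2 ^+ 2))).
      by move: sk; rewrite -/m; lra.
    by rewrite /k1 -mulrA ler_wpM2l// ler_wpM2r ?sqr_ge0// lerDl.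
  have mud : mu <= d`_n.-1 ^+ 2.
    have [d1|d1] := leP 1 (d`_n.-1 ^+ 2); first by rewrite ge_min d1.
    rewrite ge_min; apply/orP; right.
    apply: (@le_trans _ _ (\det A.1 ^+ 2)).
      by rewrite -[leRHS]real_normK ?num_real// sqr_le_sqr// ltW.
    rewrite -(det_skew GA dA); apply: le_trans (prod_sqr_le dle) _.
    have powle (x : R) : 0 <= x -> x < 1 -> x ^+ n <= x.
      by move=> x0 x1; rewrite -(prednK hn) exprS ler_piMr// exprn_ile1// ltW.
    by apply: powle; rewrite ?sqr_ge0.
  have mur : mu <= k1 * A.2 ^+ 2.
    exact: le_trans mud (le_trans (sqr_le_sum lst) sumd).
  have Cmr : Cm <= `|A.2|.
    by apply: sqrt_le => //; rewrite real_normK ?num_real// ler_pdivrMr// mulrC.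
  have volB : V * (`|\det A.1| * `|A.2|) <= Lam.
    have := le_trans vol (quotient_meas_le hr GA); rewrite lee_fin normrM mulrC -/p -/Lam.
    by rewrite ler_pdivlMr ?mulr_gt0.
  have rCp : `|A.2| <= Cp.
    rewrite ler_pdivlMr; last exact: mulr_gt0.
    by apply: le_trans volB; rewrite mulrC -mulrA ler_pM2l// ler_pM2r.
  have BBm : `|\det A.1| <= Bm.
    rewrite ler_pdivlMr; last exact: mulr_gt0.
    by apply: le_trans volB; rewrite mulrCA ler_pM2l// ler_pM2l.
  split=> //.
  + apply: le_min_norm => // z z0; apply: (systole_of_covering Gs Gc m0 cov del0 _ z0).
    rewrite det_lattice_gram ler_wpM2l ?sqr_ge0// -[\det A.1 ^+ 2]real_normK ?num_real//.
    by rewrite lef_pV2 ?posrE ?exprn_gt0// sqr_le_sqr// ltW.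
  + exists d => //; have /andP[lst0 _] := dle _ lst.
    apply: le_sqrt; first exact: ltW.
    apply: le_trans (sqr_le_sum lst) (le_trans sumd _).
    by rewrite ler_pM2l// -real_normK ?num_real// sqr_le_sqr// ltW.
  + by rewrite Cmr rCp.
Qed.
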